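(* Let $\eta^{12}(2z) = \sum_{n=1}^\infty \gamma(n)q^n$ be the unique newform in $S_6(\Gamma_0(4))$. Then for every odd prime $p$, $$\gamma(p) \equiv \sum_{\substack{k_1,k_2,k_3,k_4=0\\ k_1+k_2=k_3+k_4}}^{\frac{p-1}{2}}\ \prod_{i=1}^4\binom{\frac{p-1}{2}}{k_i}\binom{\frac{p-1}{2}+k_i}{k_i} \pmod{p^2}.$$
   Context: $\eta(z) = q^{1/24}\prod_{n\ge1}(1-q^n)$ is the Dedekind eta function, $q = e^{2\pi i z}$. The sum runs over integers $0 \le k_i \le \frac{p-1}{2}$ with $k_1+k_2 = k_3+k_4$. *)

(* Defs.v *)
From mathcomp Require Import all_boot all_order all_algebra.
Set Implicit Arguments. Unset Strict Implicit. Unset Printing Implicit Defensive.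
Import Order.TTheory GRing.Theory Num.Theory.
Local Open Scope ring_scope.

(* eta^12(2z) = q * prod_{m>=1} (1 - q^(2m))^12 = sum_{n>=1} gamma(n) q^n.
   The coefficient of q^n (n >= 1) is the coefficient of q^(n-1) in
   prod_{m>=1} (1 - q^(2m))^12; factors with m >= n do not affect degree n-1,
   so we truncate the product to 1 <= m <= n (exact, not an approximation). *)
Definition eta12_trunc (n : nat) : {poly int} :=
  \prod_(1 <= m < n.+1) (1 - 'X^(2 * m)) ^+ 12.

Definition gamma (n : nat) : int :=
  if n is n'.+1 then (eta12_trunc n)`_n' else 0.

Definition binom_term (h k : nat) : int :=
  ('C(h, k) * 'C(h + k, k))%:Z.

Definition apery_sum (p : nat) : int :=
  let h := (p.-1)./2 in
  \sum_(k1 < h.+1) \sum_(k2 < h.+1) \sum_(k3 < h.+1) \sum_(k4 < h.+1)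
    if (k1 + k2 == k3 + k4)%N then
      binom_term h k1 * binom_term h k2 * binom_term h k3 * binom_term h k4
    else 0.

(* Main.v *)
From HB Require Import structures.
Require Import Defs.
From mathcomp Require Import all_boot all_order all_algebra.
From mathcomp Require Import boolp ring zify.
Set Implicit Arguments. Unset Strict Implicit. Unset Printing Implicit Defensive.
Import Order.TTheory GRing.Theory Num.Theory.
Local Open Scope ring_scope.

(* Let x = lambda / 16 in the nome q and theta = theta_3^2.  Then
   theta = F(x) with F = sum_n C(2n,n)^2 x^n, and
   sum_n gamma(n) q^n = F(x)^4 * q dx/dq, so that gamma(p) is the residue of
   F^4 q(x)^(-p) dx.  Since log (q/x) = G/F, where F log x + G is the second
   Frobenius solution of the hypergeometric equation, one has
   (q/x)^(-p) = 1 - p G/F modulo p^2 and modulo x^p, whence gamma(p) is congruent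
   to the coefficient of x^(p-1) in F^4 - p F^3 G, hence in F^2 (F - p G/2)^2.
   Modulo p^2 the coefficients of F are (-16)^k C(h,k) C(h+k,k) with
   h = (p-1)/2, and those of F - p G/2 are the same numbers read backwards, up
   to the factor (-16)^(-h); this turns the coefficient into the sum over
   k1 + k2 = k3 + k4.

   The modular input is elementary.  The series phi(q) = sum q^(k^2) and
   psi(q) = sum q^(k(k+1)/2) have products by Gauss, for which Shanks gave finite
   forms; every identity between phi and psi and every differential equation
   needed is then invariant under q -> q^2, so its defect, having a lowest-order
   term, must vanish. *)

(** * Formal power series over a field as a commutative ring with inverses *)

Record fps (K : fieldType) := Fps { fcoef :> nat -> K }.

HB.instance Definition _ (K : fieldType) := gen_eqMixin (fps K).
HB.instance Definition _ (K : fieldType) := gen_choiceMixin (fps K).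

Section FpsRing.
Variable K : fieldType.
Implicit Types a b c : fps K.

Lemma fpsP a b : (forall n, a n = b n) -> a = b.
Proof. by case: a b => [f] [g] /= fg; congr Fps; apply/funext. Qed.

Definition fconst (k : K) : fps K := Fps (fun n => if n is 0 then k else 0).
Definition fadd a b : fps K := Fps (fun n => a n + b n).
Definition fopp a : fps K := Fps (fun n => - a n).
Definition fmul a b : fps K := Fps (fun n => \sum_(i < n.+1) a i * b (n - i)%N).
Definition ftrunc N a : {poly K} := \poly_(i < N) a i.

Lemma coefM_low (P P' Q Q' : {poly K}) n :
  (forall i, (i <= n)%N -> P`_i = P'`_i) ->
  (forall i, (i <= n)%N -> Q`_i = Q'`_i) -> (P * Q)`_n = (P' * Q')`_n.
Proof.
move=> eP eQ; rewrite !coefM; apply: eq_bigr => i _.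
by rewrite eP ?eQ ?leq_subr // -ltnS.
Qed.

Lemma coef_ftrunc N a n : (n < N)%N -> (ftrunc N a)`_n = a n.
Proof. by move=> ltnN; rewrite coef_poly ltnN. Qed.

(** Each coefficient of a product is that of a product of truncating polynomials, so commutativity
    and associativity are inherited from [{poly K}]. *)
Lemma fmulE N a b n : (n < N)%N -> fmul a b n = (ftrunc N a * ftrunc N b)`_n.
Proof.
move=> ltnN; rewrite coefM; apply: eq_bigr => i _.
rewrite !coef_ftrunc //; first by rewrite (leq_ltn_trans _ ltnN) // leq_subr.
by rewrite (leq_ltn_trans _ ltnN) // -ltnS.
Qed.

Fact faddA : associative fadd.
Proof. by move=> a b c; apply: fpsP => n /=; rewrite addrA. Qed.
Fact faddC : commutative fadd.
Proof. by move=> a b; apply: fpsP => n /=; rewrite addrC. Qed.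
Fact fadd0 : left_id (fconst 0) fadd.
Proof. by move=> a; apply: fpsP => -[|n] /=; rewrite add0r. Qed.
Fact faddN : left_inverse (fconst 0) fopp fadd.
Proof. by move=> a; apply: fpsP => -[|n] /=; rewrite addNr. Qed.
Fact fmulC : commutative fmul.
Proof. by move=> a b; apply: fpsP => n; rewrite !(@fmulE n.+1) // mulrC. Qed.
Fact fmulA : associative fmul.
Proof.
move=> a b c; apply: fpsP => n; rewrite !(@fmulE n.+1) //.
transitivity ((ftrunc n.+1 a * ftrunc n.+1 b * ftrunc n.+1 c)`_n).
  rewrite -mulrA; apply: coefM_low => // i lein.
  by rewrite coef_ftrunc // (@fmulE n.+1).
by apply: coefM_low => // i lein; rewrite coef_ftrunc // (@fmulE n.+1).
Qed.
Fact fmul1 : left_id (fconst 1) fmul.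
Proof.
move=> a; apply: fpsP => n /=; rewrite big_ord_recl /= mul1r subn0.
by rewrite big1 ?addr0 // => i _; rewrite mul0r.
Qed.
Fact fmulDl : left_distributive fmul fadd.
Proof.
move=> a b c; apply: fpsP => n /=; rewrite -big_split /=.
by apply: eq_bigr => i _; rewrite mulrDl.
Qed.
Fact fone_neq0 : fconst 1 != fconst 0.
Proof.
apply/eqP => /(congr1 (fun a : fps K => a 0%N)) /= /eqP.
by rewrite oner_eq0.
Qed.

HB.instance Definition _ := GRing.isZmodule.Build (fps K) faddA faddC fadd0 faddN.
HB.instance Definition _ := GRing.Zmodule_isComNzRing.Build (fps K)
  fmulA fmulC fmul1 fmulDl fone_neq0.

Lemma fcoefD a b n : (a + b) n = a n + b n. Proof. by []. Qed.
Lemma fcoefN a n : (- a) n = - a n. Proof. by []. Qed.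
Lemma fcoefB a b n : (a - b) n = a n - b n. Proof. by []. Qed.
Lemma fcoef0 n : (0 : fps K) n = 0. Proof. by case: n. Qed.
Lemma fcoef1 n : (1 : fps K) n = (n == 0%N)%:R. Proof. by case: n. Qed.
Lemma fcoefM a b n : (a * b) n = \sum_(i < n.+1) a i * b (n - i)%N.
Proof. by []. Qed.
Lemma fcoefM0 a b : (a * b) 0%N = a 0%N * b 0%N.
Proof. by rewrite fcoefM big_ord_recl big_ord0 addr0. Qed.
Lemma fcoefX0 a m : (a ^+ m) 0%N = a 0%N ^+ m.
Proof.
elim: m => [|m IHm]; first by rewrite !expr0 fcoef1.
by rewrite !exprS fcoefM0 IHm.
Qed.
Lemma fcoef_sum I (r : seq I) (P : pred I) (E : I -> fps K) n :
  (\sum_(i <- r | P i) E i) n = \sum_(i <- r | P i) E i n.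
Proof.
elim/big_rec2: _ => [|i y1 y2 _ <-]; last by [].
by rewrite fcoef0.
Qed.

Fact fconst_is_additive : zmod_morphism fconst.
Proof. by move=> k l; apply: fpsP => -[|n]; rewrite fcoefB //= subr0. Qed.
Fact fconst_is_multiplicative : monoid_morphism fconst.
Proof.
split=> // k l; apply: fpsP => n; rewrite fcoefM.
case: n => [|n]; first by rewrite big_ord_recl big_ord0 addr0.
rewrite big_ord_recl /= mulr0 add0r big1 // => i _; exact: mul0r.
Qed.
HB.instance Definition _ := GRing.isZmodMorphism.Build K (fps K) fconst fconst_is_additive.
HB.instance Definition _ := GRing.isMonoidMorphism.Build K (fps K) fconst fconst_is_multiplicative.

Lemma fcoefCM k a n : (fconst k * a) n = k * a n.
Proof.
rewrite fcoefM big_ord_recl /= subn0 big1 ?addr0 // => i _; exact: mul0r.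
Qed.

Lemma fcoef_natM m a n : (m%:R * a) n = m%:R * a n.
Proof. by rewrite -[m%:R in LHS](rmorph_nat fconst) fcoefCM. Qed.

Definition fX : fps K := Fps (fun n => (n == 1%N)%:R).

Lemma fcoefXM a n : (fX * a) n = if n is m.+1 then a m else 0.
Proof.
case: n => [|n]; first by rewrite fcoefM0 mul0r.
rewrite fcoefM !big_ord_recl /= mul0r mul1r add0r subSS subn0.
by rewrite big1 ?addr0 // => i _; rewrite mul0r.
Qed.

Lemma fcoefXnM a m n : (fX ^+ m * a) n = if (n < m)%N then 0 else a (n - m)%N.
Proof.
elim: m n => [|m IHm] n; first by rewrite mul1r subn0.
by rewrite exprS -mulrA fcoefXM; case: n => [//|n]; rewrite IHm subSS ltnS.
Qed.

Lemma fcoefXn m n : (fX ^+ m) n = (n == m)%:R.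
Proof.
rewrite -[_ ^+ _]mulr1 fcoefXnM fcoef1; case: ltnP => [ltnm|lemn].
  by rewrite (ltn_eqF ltnm).
by rewrite subn_eq0 eqn_leq lemn andbT.
Qed.

(* [finv_seq a n] lists the coefficients of the inverse from index n down to 0. *)
Fixpoint finv_seq a n : seq K :=
  if n is m.+1 then
    let s := finv_seq a m in
    - (a 0%N)^-1 * (\sum_(i < m.+1) a i.+1 * nth 0 s i) :: s
  else [:: (a 0%N)^-1].
(** A series without inverse is returned unchanged, as the unit-ring structure requires. *)
Definition finv a : fps K :=
  if a 0%N == 0 then a else Fps (fun n => head 0 (finv_seq a n)).
Definition funit : pred (fps K) := fun a => a 0%N != 0.

Lemma nth_finv_seq a n i : (i <= n)%N ->
  nth 0 (finv_seq a n) i = head 0 (finv_seq a (n - i)).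
Proof.
elim: n i => [|n IHn] [|i] //= lein.
by rewrite IHn // subSS.
Qed.

Fact fmulVr : {in funit, left_inverse 1 finv *%R}.
Proof.
move=> a; rewrite unfold_in => a0; apply: fpsP => n.
rewrite mulrC fcoefM fcoef1 /finv (negbTE a0) /=; case: n => [|n].
  by rewrite big_ord_recl big_ord0 addr0 /= divff.
rewrite big_ord_recl subn0 /= mulrA mulrN divff // mulN1r.
apply/eqP; rewrite addrC subr_eq0; apply/eqP; apply: eq_bigr => i _.
by rewrite subSS nth_finv_seq // -ltnS.
Qed.
Fact funit_intro a b : b * a = 1 -> funit a.
Proof.
move/(congr1 (fun c : fps K => c 0%N)); rewrite fcoefM0 fcoef1 /= => ba1.
by apply/negP => /eqP a0; move/eqP: ba1; rewrite a0 mulr0 eq_sym oner_eq0.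
Qed.
Fact finv_out : {in [predC funit], finv =1 id}.
Proof. by move=> a; rewrite inE /= unfold_in negbK /finv => ->. Qed.

HB.instance Definition _ := GRing.ComNzRing_hasMulInverse.Build (fps K)
  fmulVr funit_intro finv_out.

Lemma funitE a : (a \is a GRing.unit) = (a 0%N != 0).
Proof. by []. Qed.

Lemma fcoefV0 a : a 0%N != 0 -> (a^-1) 0%N = (a 0%N)^-1.
Proof.
move=> a0; apply: (mulIf a0); rewrite -fcoefM0 mulVr ?funitE //.
by rewrite mulVf // fcoef1.
Qed.

Lemma funit1 a : a 0%N = 1 -> a \is a GRing.unit.
Proof. by rewrite funitE => ->; rewrite oner_eq0. Qed.

End FpsRing.
Arguments fX {K}.

(** * Congruence of series modulo X^N *)

Section Congruence.
Variable K : fieldType.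
Implicit Types a b c : fps K.

Record eqm N a b : Prop := Eqm {
  eqm_coef : forall n, (n < N)%N -> a n = b n }.

Lemma eqm_refl N a : eqm N a a. Proof. by []. Qed.
Lemma eq_eqm N a b : a = b -> eqm N a b. Proof. by move->. Qed.
Lemma eqm_sym N a b : eqm N a b -> eqm N b a.
Proof. by move=> [ab]; split=> n /ab ->. Qed.
Lemma eqm_trans N b a c : eqm N a b -> eqm N b c -> eqm N a c.
Proof. by move=> [ab] [bc]; split=> n ltnN; rewrite ab ?bc. Qed.
Lemma eqm_leq M N a b : (M <= N)%N -> eqm N a b -> eqm M a b.
Proof. by move=> leMN [ab]; split=> n ltnM; apply: ab; apply: leq_trans leMN. Qed.
Lemma eqm_eq a b : (forall N, eqm N a b) -> a = b.
Proof. by move=> ab; apply: fpsP => n; apply: (eqm_coef (ab n.+1)). Qed.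
Lemma eqmD N a b a' b' : eqm N a a' -> eqm N b b' -> eqm N (a + b) (a' + b').
Proof. by move=> [ea] [eb]; split=> n ltnN; rewrite !fcoefD ea ?eb. Qed.
Lemma eqmM N a b a' b' : eqm N a a' -> eqm N b b' -> eqm N (a * b) (a' * b').
Proof.
move=> [ea] [eb]; split=> n ltnN; rewrite !fcoefM; apply: eq_bigr => i _.
rewrite ea ?eb // (leq_ltn_trans _ ltnN) //; first exact: leq_subr.
by rewrite -ltnS.
Qed.
Lemma eqmX N a b m : eqm N a b -> eqm N (a ^+ m) (b ^+ m).
Proof.
move=> ab; elim: m => [|m IHm]; first by rewrite !expr0; apply: eqm_refl.
by rewrite !exprS; apply: eqmM.
Qed.
Lemma eqm_sum N I (r : seq I) (P : pred I) (E E' : I -> fps K) :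
  (forall i, P i -> eqm N (E i) (E' i)) ->
  eqm N (\sum_(i <- r | P i) E i) (\sum_(i <- r | P i) E' i).
Proof.
move=> eE; split=> n ltnN; rewrite !fcoef_sum; apply: eq_bigr => i Pi.
exact: (eqm_coef (eE i Pi)).
Qed.

End Congruence.

(** * Composition of series and its reduction to polynomial evaluation *)

Section Composition.
Variable K : fieldType.
Implicit Types a b c x : fps K.

Lemma fcoefX_low x k n : x 0%N = 0 -> (n < k)%N -> (x ^+ k) n = 0.
Proof.
move=> x0; elim: k n => [//|k IHk] n ltnk; rewrite exprS fcoefM big1 // => i _.
case: (posnP i) => [->|i_gt0]; first by rewrite x0 mul0r.
by rewrite IHk ?mulr0 //; have := ltn_ord i; lia.
Qed.

(** The sum stops at k = n. This is the full composition when x has no constant term, since x^k then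
    starts at order k at least. *)
Definition fcomp x a : fps K := Fps (fun n => \sum_(k < n.+1) a k * (x ^+ k) n).

Lemma fcoef_comp x a n : fcomp x a n = \sum_(k < n.+1) a k * (x ^+ k) n.
Proof. by []. Qed.

Definition heval x (P : {poly K}) : fps K := (map_poly (@fconst K) P).[x].

Lemma heval_coef x (P : {poly K}) M n : (size P <= M)%N ->
  heval x P n = \sum_(k < M) P`_k * (x ^+ k) n.
Proof.
move=> szP; rewrite /heval (@horner_coef_wide _ M).
  by rewrite fcoef_sum; apply: eq_bigr => k _; rewrite coef_map fcoefCM.
exact: leq_trans (size_poly _ _) szP.
Qed.

Variable x : fps K.
Hypothesis x0 : x 0%N = 0.

Lemma heval_eqm N (P Q : {poly K}) : (forall i, (i < N)%N -> P`_i = Q`_i) ->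
  eqm N (heval x P) (heval x Q).
Proof.
move=> ePQ; split=> n ltnN; set M := maxn (size P) (size Q).
rewrite !(@heval_coef _ _ M) ?leq_maxl ?leq_maxr //.
apply: eq_bigr => k _; case: (ltnP k N) => [/ePQ -> //|leNk].
by rewrite fcoefX_low ?mulr0 // (leq_trans ltnN).
Qed.

(** Modulo X^N composition is Horner evaluation of a polynomial, a ring morphism; multiplicativity
    of [fcomp x] follows from this. *)
Lemma fcomp_eqm N a : eqm N (fcomp x a) (heval x (ftrunc N a)).
Proof.
split=> n ltnN; rewrite (@heval_coef _ _ N) ?size_poly //=.
rewrite (big_ord_widen N (fun k => a k * (x ^+ k) n)) // big_mkcond /=.
apply: eq_bigr => k _; rewrite coef_ftrunc //; case: ltnP => // ltnk.
by rewrite fcoefX_low ?mulr0.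
Qed.

Lemma fcompC k : fcomp x (fconst k) = fconst k.
Proof.
apply: fpsP => n; rewrite fcoef_comp big_ord_recl expr0 fcoef1.
rewrite big1 ?addr0; first by case: n => [|n]; rewrite ?mulr1 ?mulr0.
by move=> i _; rewrite mul0r.
Qed.
Lemma fcompM a b : fcomp x (a * b) = fcomp x a * fcomp x b.
Proof.
apply: eqm_eq => N; apply: eqm_trans (fcomp_eqm _ _) _.
apply: eqm_sym; apply: eqm_trans (eqmM (fcomp_eqm _ _) (fcomp_eqm _ _)) _.
rewrite /heval -hornerM -rmorphM; apply: heval_eqm => i ltiN.
by rewrite coef_ftrunc // -(@fmulE _ N).
Qed.
Lemma fcomp1 : fcomp x 1 = 1. Proof. exact: fcompC. Qed.
Lemma fcompD a b : fcomp x (a + b) = fcomp x a + fcomp x b.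
Proof.
apply: fpsP => n; rewrite fcoefD !fcoef_comp -big_split.
by apply: eq_bigr => k _; rewrite fcoefD mulrDl.
Qed.
Lemma fcompB a b : fcomp x (a - b) = fcomp x a - fcomp x b.
Proof.
apply: fpsP => n; rewrite fcoefB !fcoef_comp -sumrB.
by apply: eq_bigr => k _; rewrite fcoefB mulrBl.
Qed.
Lemma fcompXn a m : fcomp x (a ^+ m) = fcomp x a ^+ m.
Proof.
elim: m => [|m IHm]; first by rewrite !expr0 fcomp1.
by rewrite !exprS fcompM IHm.
Qed.
Lemma fcomp_nat m : fcomp x m%:R = m%:R.
Proof. by rewrite -[m%:R](rmorph_nat (@fconst K)) fcompC. Qed.
Lemma fcompV a : a \is a GRing.unit -> fcomp x a^-1 = (fcomp x a)^-1.
Proof.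
move=> ua; apply/esym; apply: (@mulrI _ (fcomp x a)).
  by apply/unitrPr; exists (fcomp x a^-1); rewrite -fcompM mulrV ?fcomp1.
rewrite -fcompM !mulrV ?fcomp1 //.
by apply/unitrPr; exists (fcomp x a^-1); rewrite -fcompM mulrV ?fcomp1.
Qed.
Lemma fcompX : fcomp x fX = x.
Proof.
apply: fpsP => n; rewrite fcoef_comp; case: n => [|n].
  by rewrite big_ord_recl big_ord0 mul0r x0 addr0.
rewrite !big_ord_recl mul0r add0r mul1r expr1 big1 ?addr0 // => i _.
by rewrite mul0r.
Qed.
Lemma fcoef_comp0 a : fcomp x a 0%N = a 0%N.
Proof. by rewrite fcoef_comp big_ord_recl big_ord0 addr0 expr0 fcoef1 mulr1. Qed.

End Composition.

(** * The Euler operator X d/dX *)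

Section Derivation.
Variable K : fieldType.
Implicit Types a b c x : fps K.

(** This is X d/dX rather than d/dX: it preserves indices, and it commutes with X -> X^2 up to the
    factor 2. *)
Definition fder a : fps K := Fps (fun n => n%:R * a n).

Lemma fcoef_der a n : fder a n = n%:R * a n. Proof. by []. Qed.
Lemma fderD a b : fder (a + b) = fder a + fder b.
Proof. by apply: fpsP => n; rewrite fcoefD !fcoef_der fcoefD mulrDr. Qed.
Lemma fderN a : fder (- a) = - fder a.
Proof. by apply: fpsP => n; rewrite fcoefN !fcoef_der fcoefN mulrN. Qed.
Lemma fderB a b : fder (a - b) = fder a - fder b.
Proof. by rewrite fderD fderN. Qed.
Lemma fderM a b : fder (a * b) = fder a * b + a * fder b.
Proof.
apply: fpsP => n; rewrite fcoefD fcoef_der !fcoefM mulr_sumr -big_split.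
apply: eq_bigr => i _; rewrite !fcoef_der; have lein : (i <= n)%N by rewrite -ltnS.
have -> : n%:R = i%:R + (n - i)%:R :> K by rewrite -natrD subnKC.
rewrite /=; ring.
Qed.
Lemma fderC k : fder (fconst k) = 0.
Proof. by apply: fpsP => -[|n] /=; rewrite ?mul0r ?mulr0. Qed.
Lemma fder_nat m : fder m%:R = 0.
Proof. by rewrite -[m%:R](rmorph_nat (@fconst K)) fderC. Qed.
Lemma fder1 : fder 1 = 0. Proof. exact: fderC. Qed.
Lemma fderX : fder fX = fX.
Proof. by apply: fpsP => -[|[|n]] /=; rewrite ?mulr0 ?mulr1. Qed.
Lemma fderXn a m : fder (a ^+ m.+1) = m.+1%:R * a ^+ m * fder a.
Proof.
elim: m => [|m IHm]; first by rewrite expr1 expr0 !mul1r.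
by rewrite exprS fderM IHm exprS -(natr1 m.+1); ring.
Qed.
Lemma fderV a : a \is a GRing.unit -> fder a^-1 = - (a^-1 ^+ 2 * fder a).
Proof.
move=> ua; apply: (mulrI ua).
have: fder (a * a^-1) = 0 by rewrite mulrV // fder1.
rewrite fderM => /eqP; rewrite addrC addr_eq0 => /eqP ->.
by rewrite mulrN expr2 !mulrA mulrV // mul1r mulrC.
Qed.

(** Chain rule, with y the logarithmic derivative of x. It is checked on the powers x^k, which the
    operator multiplies by k y. *)
Lemma fder_comp x y a : x 0%N = 0 -> fder x = x * y ->
  fder (fcomp x a) = fcomp x (fder a) * y.
Proof.
move=> x0 dx; apply: eqm_eq => N.
have dxk k : fder (x ^+ k) = k%:R * x ^+ k * y.
  case: k => [|k]; first by rewrite expr0 fder1 !mul0r.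
  by rewrite fderXn dx exprS; ring.
apply: (@eqm_trans _ _ (\sum_(k < N) fconst (a k) * fder (x ^+ k))); last first.
  under eq_bigr => k _ do rewrite dxk !mulrA.
  rewrite -mulr_suml; apply: eqmM; last exact: eqm_refl.
  split=> n ltnN; rewrite (eqm_coef (fcomp_eqm x0 _ (fder a)) ltnN).
  rewrite (@heval_coef _ _ _ N) ?size_poly // fcoef_sum.
  apply: eq_bigr => k _; rewrite -mulrA fcoefCM coef_ftrunc // fcoef_der.
  by rewrite -[k%:R](rmorph_nat (@fconst K)) fcoefCM; ring.
split=> n ltnN; rewrite fcoef_der (eqm_coef (fcomp_eqm x0 _ a) ltnN).
rewrite (@heval_coef _ _ _ N) ?size_poly // fcoef_sum mulr_sumr.
by apply: eq_bigr => k _; rewrite coef_ftrunc // fcoefCM fcoef_der; ring.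
Qed.

End Derivation.

(** * The substitution q -> q^2 *)

Section Square.
Variable K : fieldType.
Implicit Types a b c : fps K.

Definition fsq : fps K -> fps K := fcomp (fX ^+ 2).

Lemma fX2_0 : (fX ^+ 2 : fps K) 0%N = 0. Proof. by rewrite fcoefXn. Qed.
Lemma fsqM a b : fsq (a * b) = fsq a * fsq b. Proof. exact: fcompM fX2_0 _ _. Qed.
Lemma fsqD a b : fsq (a + b) = fsq a + fsq b. Proof. exact: fcompD. Qed.
Lemma fsqB a b : fsq (a - b) = fsq a - fsq b. Proof. exact: fcompB. Qed.
Lemma fsq1 : fsq 1 = 1. Proof. exact: fcomp1. Qed.
Lemma fsq_nat m : fsq m%:R = m%:R. Proof. exact: fcomp_nat. Qed.
Lemma fsqXn a m : fsq (a ^+ m) = fsq a ^+ m. Proof. exact: fcompXn fX2_0 _ _. Qed.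
Lemma fsqX : fsq fX = fX ^+ 2. Proof. exact: fcompX fX2_0. Qed.
Lemma fsqV a : a \is a GRing.unit -> fsq a^-1 = (fsq a)^-1.
Proof. exact: fcompV fX2_0 _. Qed.
Lemma fsq_prod I (r : seq I) (P : pred I) (E : I -> fps K) :
  fsq (\prod_(i <- r | P i) E i) = \prod_(i <- r | P i) fsq (E i).
Proof. exact: (big_morph fsq fsqM fsq1). Qed.
Lemma fsq_coef0 a : fsq a 0%N = a 0%N. Proof. exact: fcoef_comp0. Qed.

Lemma fcoef_sq a n : fsq a n = if odd n then 0 else a n./2.
Proof.
rewrite fcoef_comp; under eq_bigr => k _ do rewrite -exprM fcoefXn mulr_natr.
case: ifPn => [odn|evn].
  rewrite big1 // => k _; case: eqP => // en; exfalso; lia.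
have hn : (n./2 < n.+1)%N by lia.
rewrite (bigD1 (Ordinal hn)) //= mul2n even_halfK // eqxx mulr1n.
rewrite big1 ?addr0 // => k nk; case: eqP => // en; case/eqP: nk.
by apply: val_inj => /=; lia.
Qed.

Lemma fsq_eqm N a b : eqm N a b -> eqm (2 * N)%N (fsq a) (fsq b).
Proof.
move=> [ab]; split=> n ltnN; rewrite !fcoef_sq; case: ifP => // _; apply: ab; lia.
Qed.

Lemma fder_sq a : fder (fsq a) = 2%:R * fsq (fder a).
Proof.
rewrite mulrC; apply: fder_comp; first exact: fX2_0.
by rewrite fderXn fderX; ring.
Qed.

(* Comparing lowest-order terms: [fsq a] starts at twice the order of [a]. *)
Lemma fsq_fixed g a : a 0%N = 0 -> a = g * fsq a -> a = 0.
Proof.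
move=> a0 ag; apply: fpsP => n; rewrite fcoef0.
elim/ltn_ind: n => n IHn; case: (posnP n) => [-> //|n_gt0].
rewrite ag fcoefM big1 // => i _; rewrite fcoef_sq.
case: ifP => _; rewrite ?mulr0 // IHn ?mulr0 //; lia.
Qed.

End Square.

(** * Lacunary series and their dissection *)

Section Lacunary.

Lemma sum_double (V : zmodType) (E : nat -> V) N :
  \sum_(k < 2 * N) E k = \sum_(j < N) (E (2 * j)%N + E (2 * j).+1).
Proof.
elim: N => [|N IHN]; first by rewrite muln0 !big_ord0.
by rewrite mulnS !add2n !big_ord_recr IHN /= addrA.
Qed.

Variable K : fieldType.

(** The series sum_k w(k) X^(e k). The bound k <= n loses no term as soon as k <= e k, the
    hypothesis carried by the lemmas that manipulate exponents. *)
Definition flac (w : nat -> K) (e : nat -> nat) : fps K :=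
  Fps (fun n => \sum_(k < n.+1) w k * (n == e k)%:R).

Lemma fcoef_lac w e n : flac w e n = \sum_(k < n.+1) w k * (n == e k)%:R.
Proof. by []. Qed.

Lemma flac_eqm w e N : (forall k, k <= e k)%N ->
  eqm N (flac w e) (\sum_(k < N) fconst (w k) * fX ^+ e k).
Proof.
move=> lek; split=> n ltnN; rewrite fcoef_sum fcoef_lac.
rewrite (big_ord_widen N (fun k => w k * (n == e k)%:R)) // big_mkcond.
apply: eq_bigr => k _; rewrite fcoefCM fcoefXn; case: ltnP => // ltnk.
by case: eqP => [en|]; rewrite ?mulr0 //; have := lek k; lia.
Qed.

Lemma fsq_lac w e : (forall k, k <= e k)%N ->
  fsq (flac w e) = flac w (fun k => 2 * e k)%N.
Proof.
move=> lek; apply: eqm_eq => N; have lek2 k : (k <= 2 * e k)%N by have := lek k; lia.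
apply: eqm_trans _ (eqm_sym (flac_eqm _ _ lek2)).
have leN2 : (N <= 2 * N)%N by lia.
apply: eqm_trans (eqm_leq leN2 (fsq_eqm (flac_eqm w _ lek))) _.
rewrite /fsq (big_morph _ (@fcompD _ (fX ^+ 2)) (@fcompC _ _ 0)).
apply: eqm_sum => k _; rewrite fcompM ?fX2_0 // fcompC fcompXn ?fX2_0 //.
by rewrite fcompX ?fX2_0 // -exprM; apply: eqm_refl.
Qed.

Lemma flac_split (w : nat -> K) e : (forall k, k <= e k)%N ->
  flac w e = flac (fun j => w (2 * j)%N) (fun j => e (2 * j)%N)
           + flac (fun j => w (2 * j).+1) (fun j => e (2 * j).+1).
Proof.
move=> lek; apply: eqm_eq => N.
have le0 k : (k <= e (2 * k))%N by have := lek (2 * k)%N; lia.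
have le1 k : (k <= e (2 * k).+1)%N by have := lek (2 * k).+1; lia.
apply: eqm_trans _ (eqm_sym (eqmD (flac_eqm _ _ le0) (flac_eqm _ _ le1))).
have leN2 : (N <= 2 * N)%N by lia.
apply: eqm_trans (eqm_leq leN2 (flac_eqm w _ lek)) _.
by rewrite -big_split (sum_double (fun k => fconst (w k) * fX ^+ e k)).
Qed.

Lemma flac_shift w e : (forall k, k <= e k)%N ->
  fX * flac w e = flac w (fun k => (e k).+1).
Proof.
move=> lek; apply: eqm_eq => N.
have le1 k : (k <= (e k).+1)%N by have := lek k; lia.
apply: eqm_trans _ (eqm_sym (flac_eqm _ _ le1)).
apply: eqm_trans (eqmM (eqm_refl _ _) (flac_eqm w _ lek)) _.
rewrite mulr_sumr; apply: eqm_sum => k _; rewrite exprS mulrCA; exact: eqm_refl.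
Qed.

Lemma flacZ (c : K) w e : fconst c * flac w e = flac (fun k => c * w k) e.
Proof.
apply: fpsP => n; rewrite fcoefCM !fcoef_lac mulr_sumr.
by apply: eq_bigr => k _; rewrite mulrA.
Qed.

Lemma eq_flac w w' e e' : w =1 w' -> e =1 e' -> flac w e = flac w' e'.
Proof.
by move=> ew ee; apply: fpsP => n; apply: eq_bigr => k _; rewrite ew ee.
Qed.

End Lacunary.

(** * Gauss's product for the squares, in a variable t later taken to be q and -q *)

Lemma eqm_lowM (K : fieldType) (t a : fps K) N m : t 0%N = 0 -> (N <= m)%N ->
  eqm N (t ^+ m * a) 0.
Proof.
move=> t0 leNm; split=> n ltnN; rewrite fcoef0 fcoefM big1 // => i _.
by rewrite fcoefX_low ?mul0r //; have := ltn_ord i; lia.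
Qed.

Lemma unit_1Dt (t : fps rat) k : t 0%N = 0 -> 1 + t ^+ k \is a GRing.unit.
Proof.
by move=> t0; rewrite funitE fcoefD fcoef1 fcoefX0 t0; case: k => [|k]; rewrite ?expr0 ?expr0n.
Qed.

Lemma unit_1Bt (t : fps rat) k : t 0%N = 0 -> 1 - t ^+ k.+1 \is a GRing.unit.
Proof. by move=> t0; rewrite funitE fcoefB fcoef1 fcoefX0 t0 expr0n. Qed.

Section GaussSquares.
Variable t : fps rat.
Hypothesis t0 : t 0%N = 0.

(** Coefficients of sum (-1)^k t^(k^2) over all integers k, with k and -k folded together. *)
Definition sqw (k : nat) : rat := if k == 0%N then 1 else 2 * (-1) ^+ k.

Let r k : fps rat := (1 - t ^+ k.+1) / (1 + t ^+ k.+1).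
Let tau s n : fps rat :=
  (-1) ^+ s * 2 * t ^+ (s * n.+1) / (1 + t ^+ s) * \prod_(s <= k < n) r k.
(** [B0] and [B1] form a telescoping certificate: the increment of [tau] in n is [B1 n s - B0 n s],
    and [B0] at s + 1 equals [B1] at s. *)
Let B0 n s : fps rat := (-1) ^+ s * 2 * t ^+ (s * n.+1) * (1 - t ^+ s)
  / (1 + t ^+ s) / (1 + t ^+ n.+1) * \prod_(s <= k < n) r k.
Let B1 n s : fps rat := - ((-1) ^+ s * 2 * t ^+ (s * n.+1) * t ^+ n.+1
  / (1 + t ^+ n.+1) * \prod_(s <= k < n) r k).

Let tau_diff n s : (s <= n)%N -> tau s n.+1 - tau s n = B1 n s - B0 n s.
Proof.
move=> lesn; rewrite /tau /B0 /B1 big_nat_recr //= -/(r _) [r n]/r.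
set P := \prod_(_ <= _ < _) _; rewrite (mulnS s n.+1) exprD.
have := mulrV (unit_1Dt n.+1 t0); have := mulrV (unit_1Dt s t0).
set iw := (1 + t ^+ s)^-1; set iv := (1 + t ^+ n.+1)^-1.
set Z := t ^+ (s * n.+1); move: (t ^+ s) (t ^+ n.+1) => y T.
move: iw iv Z P ((-1) ^+ s) => iw iv Z P e e1 e2.
(* [ring] treats the inverses [iw] and [iv] as free variables; the last summand collects the
   multiples of their defining relations, which vanish. *)
have -> : e * 2 * (y * Z) * iw * (P * ((1 - T) * iv)) - e * 2 * Z * iw * P
  = - (e * 2 * Z * T * iv * P) - e * 2 * Z * (1 - y) * iw * iv * P
  + e * 2 * Z * P * (iw * ((1 + T) * iv - 1) - T * iv * ((1 + y) * iw - 1)) by ring.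
by rewrite e1 e2 subrr !mulr0 subr0 mulr0 addr0.
Qed.

Let B0S n s : (s < n)%N -> B0 n s.+1 = B1 n s.
Proof.
move=> ltsn; rewrite /B0 /B1 [in RHS]big_ltn // {2}/r exprS mulSn exprD.
by ring.
Qed.

(* Shanks' finite form of Gauss's identity; only the [s = 0] term of the
   right-hand side survives modulo [t ^+ n.+1]. *)
Lemma shanks_squares n : \sum_(k < n.+1) fconst (sqw k) * t ^+ (k ^ 2)
  = \sum_(s < n.+1) tau s n.
Proof.
elim: n => [|n IHn].
  rewrite !big_ord_recl !big_ord0 /tau /= big_geq // !mulr1 ?mul0n !expr0 !mul1r.
  have -> : (2 : fps rat) / (1 + 1) = 1 by rewrite -[1 + 1]/(2) divrr ?funitE.
  by rewrite /sqw /= rmorph1 ?expr0 ?mulr1.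
rewrite big_ord_recr /= IHn [RHS]big_ord_recr /=.
have -> : \sum_(i < n.+1) tau i n.+1
  = \sum_(i < n.+1) tau i n + \sum_(i < n.+1) (B1 n i - B0 n i).
  rewrite -big_split; apply: eq_bigr => i _ /=.
  have lein : (i <= n)%N by rewrite -ltnS.
  by rewrite -(tau_diff lein) [RHS]addrC subrK.
(* After telescoping only [B1 n n] remains, since [B0 n 0] contains 1 - t^0. Added to the new term
   [tau n.+1 n.+1] it gives the next square term. *)
rewrite -addrA; congr (_ + _); rewrite sumrB big_ord_recr [X in _ - X]big_ord_recl /=.
have -> : \sum_(i < n) B0 n (bump 0 i) = \sum_(i < n) B1 n i.
  by apply: eq_bigr => i _; rewrite /bump /= B0S.
have -> : B0 n 0%N = 0 by rewrite /B0 expr0 subrr mulr0 !mul0r.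
rewrite add0r [_ + B1 n n]addrC addrK /B1 /tau !big_geq // !mulr1.
have := mulrV (unit_1Dt n.+1 t0); set iv := _^-1 => e.
rewrite /sqw /= rmorphM rmorphXn rmorphN rmorph1 (rmorph_nat _ 2).
have -> : (n.+1 ^ 2 = n * n.+1 + n.+1)%N by lia.
have -> : (n.+1 * n.+2 = n * n.+1 + n.+1 + n.+1)%N by lia.
rewrite !exprD [(-1) ^+ n.+1]exprS.
move: (t ^+ n.+1) (t ^+ (n * n.+1)) ((-1) ^+ n : fps rat) iv e => T Z s iv e.
have -> : 2 * (-1 * s) * (Z * T) = 2 * (-1 * s) * (Z * T) * ((1 + T) * iv).
  by rewrite e mulr1.
by ring.
Qed.

Lemma gauss_squares n : eqm n.+1 (\sum_(k < n.+1) fconst (sqw k) * t ^+ (k ^ 2))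
  (\prod_(0 <= k < n) ((1 - t ^+ k.+1) / (1 + t ^+ k.+1))).
Proof.
rewrite shanks_squares big_ord_recl -[X in eqm _ _ X]addr0; apply: eqmD.
  rewrite /tau /= expr0 mul0n expr0 mul1r mulr1 -[1 + 1]/(2) divrr ?funitE //.
  by rewrite mul1r; apply: eqm_refl.
split=> m ltmn; rewrite fcoef0 fcoef_sum big1 // => i _.
rewrite /tau [_ * t ^+ _]mulrC -!mulrA.
by rewrite (eqm_coef (eqm_lowM _ t0 _) ltmn) ?fcoef0 // leq_pmull.
Qed.

End GaussSquares.

(** * Gauss's product for the triangular numbers *)

Section GaussTriangular.
Notation q := (fX : fps rat).
Let q0 : q 0%N = 0. Proof. by []. Qed.

Definition tri k := (k * k.+1)./2.
Arguments tri : simpl never.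

Let r k : fps rat := (1 - q ^+ (2 * k).+2) / (1 - q ^+ (2 * k).+1).
Let tau s n : fps rat := q ^+ (s * (2 * n).+1) * \prod_(s <= k < n) r k.
(** Here a single certificate suffices: the increment of [tau] in n is the difference of [B0] in
    s. *)
Let B0 n s : fps rat := q ^+ (s * (2 * n).+1) * (1 - q ^+ (2 * s)) / (1 - q ^+ (2 * n).+1)
  * \prod_(s <= k < n) r k.

Let tau_diff n s : (s < n)%N -> tau s n.+1 - tau s n = B0 n s.+1 - B0 n s.
Proof.
move=> ltsn; rewrite /tau /B0 big_nat_recr 1?ltnW //= [r n]/r.
rewrite (big_ltn ltsn) [r s]/r.
set P := \prod_(_ <= _ < _) _.
have -> : (s * (2 * n.+1).+1 = s * (2 * n).+1 + 2 * s)%N by lia.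
have -> : (s.+1 * (2 * n).+1 = s * (2 * n).+1 + (2 * n).+1)%N by lia.
have -> : (2 * s.+1 = (2 * s).+2)%N by lia.
have := mulrV (unit_1Bt (2 * n) q0); have := mulrV (unit_1Bt (2 * s) q0).
rewrite exprD exprD; move: (q ^+ (s * (2 * n).+1)) P => Z P; rewrite !exprS.
set iw := (1 - q * q ^+ (2 * s))^-1; set iv := (1 - q * q ^+ (2 * n))^-1.
move: q (q ^+ (2 * s)) (q ^+ (2 * n)) iw iv => x y T iw iv e1 e2.
apply/eqP; rewrite -subr_eq0; apply/eqP.
transitivity (Z * P * (1 - x * (x * y)) * (iw * ((1 - x * T) * iv - 1)
  + x * T * iv * ((1 - x * y) * iw - 1))); first by ring.
by rewrite e1 e2 subrr !mulr0 addr0 mulr0.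
Qed.

Lemma triE k : (2 * tri k = k * k.+1)%N.
Proof.
have : ~~ odd (k * k.+1) by rewrite oddM /=; case: odd.
by rewrite /tri; lia.
Qed.

(** Shanks' finite form for triangular numbers. Raising n by one adds two terms on the left; on the
    right the telescoping sum leaves [B0 n n], which joins the new term [tau n n.+1]. *)
Lemma shanks_triangular n : \sum_(k < 2 * n) q ^+ tri k = \sum_(s < n) tau s n.
Proof.
elim: n => [|n IHn]; first by rewrite muln0 !big_ord0.
have -> : (2 * n.+1 = (2 * n).+2)%N by lia.
rewrite !big_ord_recr /= IHn.
have -> : \sum_(i < n) tau i n.+1
  = \sum_(i < n) tau i n + \sum_(i < n) (B0 n i.+1 - B0 n i).
  rewrite -big_split; apply: eq_bigr => i _ /=.
  by rewrite -(tau_diff (ltn_ord i)) [RHS]addrC subrK.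
rewrite -!addrA; congr (_ + _).
rewrite -(big_mkord xpredT (fun i => B0 n i.+1 - B0 n i)) telescope_sumr //.
have -> : B0 n 0%N = 0 by rewrite /B0 muln0 expr0 subrr mulr0 !mul0r.
rewrite subr0 /B0 /tau big_nat1 big_geq // mulr1 /r.
have -> : (tri (2 * n) = n * (2 * n).+1)%N by have := triE (2 * n); nia.
have -> : (tri (2 * n).+1 = n * (2 * n).+1 + (2 * n).+1)%N.
  by have := triE (2 * n).+1; nia.
have -> : (n * (2 * n.+1).+1 = n * (2 * n).+1 + 2 * n)%N by lia.
have := mulrV (unit_1Bt (2 * n) q0).
rewrite [q ^+ (_ + (2 * n).+1)]exprD [q ^+ (_ + 2 * n)]exprD.
move: (q ^+ (n * (2 * n).+1)) => Z; rewrite !exprS.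
set iv := (1 - q * q ^+ (2 * n))^-1; move: q (q ^+ (2 * n)) iv => x T iv e.
have -> : Z + Z * (x * T) = (Z + Z * (x * T)) * ((1 - x * T) * iv) by rewrite e mulr1.
by ring.
Qed.

(** The term s = 0 is the product; all others are divisible by q^(2n+3). *)
Lemma gauss_triangular n : eqm (2 * n).+1 (\sum_(k < 2 * n.+1) q ^+ tri k)
  (\prod_(0 <= k < n.+1) ((1 - q ^+ (2 * k).+2) / (1 - q ^+ (2 * k).+1))).
Proof.
rewrite shanks_triangular big_ord_recl -[X in eqm _ _ X]addr0; apply: eqmD.
  by rewrite /tau /= mul0n expr0 mul1r; apply: eqm_refl.
split=> m ltmn; rewrite fcoef0 fcoef_sum big1 // => i _.
by rewrite /tau (eqm_coef (eqm_lowM _ q0 _) ltmn) ?fcoef0 // (leq_trans _ (leq_pmull _ _)) //; lia.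
Qed.

End GaussTriangular.

(** * Theta series *)

Local Notation q := (fX : fps rat).

(* theta_3(q), theta_4(q), and psi with theta_2(q) = 2 q^(1/4) psi(q^2). *)
Definition thp : fps rat := flac (fun k => if k == 0%N then 1 else 2) (fun k => k ^ 2)%N.
Definition thm : fps rat := flac sqw (fun k => k ^ 2)%N.
Definition psi : fps rat := flac (fun _ => 1) tri.

Lemma leq_sqr k : (k <= k ^ 2)%N. Proof. by nia. Qed.
Lemma leq_tri k : (k <= tri k)%N. Proof. by have := triE k; nia. Qed.
Lemma q0 : q 0%N = 0. Proof. by []. Qed.
Lemma qN0 : (- q) 0%N = 0. Proof. by rewrite fcoefN oppr0. Qed.

Lemma thm_prod n :
  eqm n.+1 thm (\prod_(0 <= k < n) ((1 - q ^+ k.+1) / (1 + q ^+ k.+1))).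
Proof.
apply: eqm_trans (@flac_eqm _ _ _ _ leq_sqr) _; exact: (@gauss_squares _ q0 n).
Qed.

Lemma thp_prod n :
  eqm n.+1 thp (\prod_(0 <= k < n) ((1 - (- q) ^+ k.+1) / (1 + (- q) ^+ k.+1))).
Proof.
apply: eqm_trans (flac_eqm _ _ leq_sqr) _.
apply: eqm_trans _ (@gauss_squares _ qN0 n); apply: eqm_sum => k _.
rewrite [(- q) ^+ _]exprNn /sqw; case: eqVneq => [->|k0].
  by rewrite exp0n // !expr0 !mulr1; apply: eqm_refl.
rewrite mulrA rmorphM rmorphXn rmorphN rmorph1.
rewrite -[_ * _ * (-1) ^+ (k ^ 2)]mulrA -exprD.
(* k + k^2 is even, so the sign in [sqw] cancels that of (-q)^(k^2). *)
have -> : (-1) ^+ (k + k ^ 2) = 1 :> fps rat.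
  by rewrite -signr_odd oddD oddX /= addbb.
by rewrite mulr1; apply: eqm_refl.
Qed.

Lemma psi_prod n : eqm (2 * n).+1 psi
  (\prod_(0 <= k < n.+1) ((1 - q ^+ (2 * k).+2) / (1 - q ^+ (2 * k).+1))).
Proof.
apply: eqm_trans _ (@gauss_triangular n).
have le2 : ((2 * n).+1 <= 2 * n.+1)%N by lia.
apply: eqm_trans (eqm_leq le2 (flac_eqm _ _ leq_tri)) _.
by apply: eqm_sum => k _; rewrite rmorph1 mul1r; apply: eqm_refl.
Qed.

Lemma prod_double (R : comPzRingType) (E : nat -> R) n :
  \prod_(0 <= k < 2 * n) E k = \prod_(0 <= j < n) (E (2 * j)%N * E (2 * j).+1).
Proof.
elim: n => [|n IHn]; first by rewrite muln0 !big_geq.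
have -> : (2 * n.+1 = (2 * n).+2)%N by lia.
by rewrite !big_nat_recr //= IHn mulrA.
Qed.

Lemma Nq_odd k : (- q) ^+ (2 * k).+1 = - q ^+ (2 * k).+1.
Proof. by rewrite exprNn -signr_odd /= oddM expr1 mulN1r. Qed.
Lemma Nq_even k : (- q) ^+ (2 * k).+2 = q ^+ (2 * k).+2.
Proof. by rewrite exprNn -signr_odd /= oddM mul1r. Qed.

(** Grouping the factors by parity of the exponent settles the signs of the powers of -q. *)
Lemma thp_prod2 n : eqm (2 * n).+1 thp (\prod_(0 <= k < n)
   ((1 + q ^+ (2 * k).+1) / (1 - q ^+ (2 * k).+1)
     * ((1 - q ^+ (2 * k).+2) / (1 + q ^+ (2 * k).+2)))).
Proof.
apply: eqm_trans (@thp_prod (2 * n)) _; rewrite prod_double.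
by apply: eq_eqm; apply: eq_bigr => k _; rewrite Nq_odd Nq_even opprK.
Qed.

Lemma thm_prod2 n : eqm (2 * n).+1 thm (\prod_(0 <= k < n)
   ((1 - q ^+ (2 * k).+1) / (1 + q ^+ (2 * k).+1)
     * ((1 - q ^+ (2 * k).+2) / (1 + q ^+ (2 * k).+2)))).
Proof.
by apply: eqm_trans (@thm_prod (2 * n)) _; rewrite prod_double; apply: eqm_refl.
Qed.

Lemma fsq_1Bq m : fsq (1 - q ^+ m) = 1 - q ^+ (2 * m).
Proof. by rewrite fsqB fsq1 fsqXn fsqX exprM. Qed.
Lemma fsq_1Dq m : fsq (1 + q ^+ m) = 1 + q ^+ (2 * m).
Proof. by rewrite fsqD fsq1 fsqXn fsqX exprM. Qed.

(** psi(q)^2 = psi(q^2) phi(q) holds factor by factor in Gauss's products, by 1 - u^2 = (1 - u)(1 +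
    u). *)
Lemma psi_sqr : psi ^+ 2 = fsq psi * thp.
Proof.
apply: eqm_eq => N; have leN : (N <= (2 * N).+1)%N by lia.
apply: eqm_leq leN _.
have leN2 : ((2 * N).+1 <= 2 * (2 * N).+1)%N by lia.
have leN3 : ((2 * N).+1 <= (2 * N.+1).+1)%N by lia.
apply: eqm_sym; apply: eqm_trans (eqmM (eqm_leq leN2 (fsq_eqm (@psi_prod N)))
  (eqm_leq leN3 (@thp_prod2 N.+1))) _.
apply: eqm_sym; apply: eqm_trans (eqmX 2 (@psi_prod N)) _.
rewrite fsq_prod -big_split -prodrXl /=.
apply: eq_eqm; apply: eq_bigr => k _; rewrite fsqM fsqV ?unit_1Bt // !fsq_1Bq.
rewrite ![(2 * _.+1)%N]mulnC ![(_ ^+ (_.+1 * 2))]exprM.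
have := mulrV (unit_1Dt (2 * k).+1 q0); have := mulrV (unit_1Dt (2 * k).+2 q0).
have: 1 - q ^+ (2 * k).+1 \is a GRing.unit by rewrite unit_1Bt.
have: 1 + q ^+ (2 * k).+1 \is a GRing.unit by rewrite unit_1Dt.
move: (q ^+ (2 * k).+1) (q ^+ (2 * k).+2) => u w u1 u2.
have -> : 1 - u ^+ 2 = (1 - u) * (1 + u) by ring.
rewrite invrM //; move: (1 - u)^-1 (1 + u)^-1 (1 + w)^-1 => iu iU iW eW eU.
transitivity ((1 - w) ^+ 2 * iu ^+ 2 * ((1 + w) * iW) * ((1 + u) * iU)).
  by rewrite eW eU; ring.
by ring.
Qed.

(** phi(q) phi(-q) = phi(-q^2)^2, again factor by factor: the odd-exponent quotients in the products
    of phi(q) and phi(-q) are mutually inverse. *)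
Lemma thp_thm : thp * thm = fsq thm ^+ 2.
Proof.
apply: eqm_eq => N; have leN : (N <= (2 * N).+1)%N by lia.
apply: eqm_leq leN _.
have leN2 : ((2 * N).+1 <= 2 * N.+1)%N by lia.
apply: eqm_trans (eqmM (@thp_prod2 N) (@thm_prod2 N)) _.
apply: eqm_sym; apply: eqm_trans (eqmX 2 (eqm_leq leN2 (fsq_eqm (@thm_prod N)))) _.
rewrite fsq_prod -big_split -prodrXl /=.
apply: eq_eqm; apply: eq_bigr => k _; rewrite fsqM fsqV ?unit_1Dt // fsq_1Bq fsq_1Dq mulnS add2n.
have := mulrV (unit_1Dt (2 * k).+1 q0); have := mulrV (unit_1Bt (2 * k) q0).
move: (q ^+ (2 * k).+1) (q ^+ (2 * k).+2) => u w.
move: (1 - u)^-1 (1 + u)^-1 (1 + w)^-1 => iu iU iW eu eU.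
transitivity ((1 - w) ^+ 2 * iW ^+ 2 * ((1 - u) * iu) * ((1 + u) * iU)).
  by rewrite eu eU; ring.
by ring.
Qed.

(** With N, D, O the products of 1 - q^k, 1 + q^k and 1 - q^(2k-1), one has phi(-q) = N/D and psi =
    ND/O, so the left side is N^3/(DO); Euler's DO = 1 concludes. *)
Lemma eta_cube n :
  eqm n.+1 (psi * thm ^+ 2) ((\prod_(0 <= k < n) (1 - q ^+ k.+1)) ^+ 3).
Proof.
have le1 : (n.+1 <= (2 * n.+1).+1)%N by lia.
set N := \prod_(_ <= _ < _) _; set D := \prod_(0 <= k < n) (1 + q ^+ k.+1).
pose O := \prod_(0 <= k < n) (1 - q ^+ (2 * k).+1).
have uB k : 1 - q ^+ k.+1 \is a GRing.unit by rewrite unit_1Bt.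
have uprod (E : nat -> fps rat) m : (forall k, E k \is a GRing.unit) ->
    \prod_(0 <= k < m) E k \is a GRing.unit.
  by move=> uE; elim/big_ind: _ => // a b ua ub; rewrite unitrM ua.
have uN : N \is a GRing.unit by apply: uprod.
have uD : D \is a GRing.unit by apply: uprod => k; rewrite unit_1Dt.
have uO : O \is a GRing.unit by apply: uprod => k; apply: uB.
have prodV (E : nat -> fps rat) m : (forall k, E k \is a GRing.unit) ->
    \prod_(0 <= k < m) (E k)^-1 = (\prod_(0 <= k < m) E k)^-1.
  move=> uE; elim: m => [|m IHm]; first by rewrite !big_geq ?invr1.
  by rewrite !big_nat_recr //= IHm invrM ?uprod // mulrC.
have hm : eqm n.+1 thm (N / D).
  apply: eqm_trans (@thm_prod n) _; rewrite big_split /=.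
  by rewrite prodV => [|k]; [apply: eqm_refl | rewrite unit_1Dt].
have ND : N * D = \prod_(0 <= k < n) (1 - q ^+ (2 * k).+2).
  rewrite -big_split; apply: eq_bigr => k _ /=.
  by rewrite -[(2 * k).+2]/(2 + 2 * k)%N -mulnS mulnC exprM; ring.
have hp : eqm n.+1 psi (N * D / O).
  have le2 : (n.+1 <= (2 * n).+1)%N by lia.
  apply: eqm_trans (eqm_leq le2 (@psi_prod n)) _.
  have -> : N * D / O
    = \prod_(0 <= k < n) ((1 - q ^+ (2 * k).+2) / (1 - q ^+ (2 * k).+1)).
    by rewrite big_split /= ND prodV // => k; apply: uB.
  (* [psi_prod] carries one factor more than the other products; it is 1 modulo q^(2n+1). *)
  rewrite big_nat_recr //= -[X in eqm _ _ X]mulr1; apply: eqmM; first exact: eqm_refl.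
  have u1 := mulrV (uB (2 * n)%N); move: (_^-1) u1 => iv u1.
  have -> : (1 - q ^+ (2 * n).+2) * iv
    = 1 + q ^+ (2 * n).+1 * ((1 - q) * iv) + ((1 - q ^+ (2 * n).+1) * iv - 1).
    by rewrite [q ^+ _.+2]exprS; ring.
  rewrite u1 subrr addr0 -[X in eqm _ _ X]addr0; apply: eqmD; first exact: eqm_refl.
  by apply: eqm_lowM; [exact: q0 | lia].
(* N D O is the product of the first 2n factors 1 - q^k; its first half is N and its second half is
   1 modulo q^(n+1). *)
have DO : eqm n.+1 (D * O) 1.
  have e : N * (D * O) = \prod_(0 <= k < 2 * n) (1 - q ^+ k.+1).
    by rewrite mulrA ND -big_split prod_double; apply: eq_bigr => k _; rewrite mulrC.
  have -> : D * O = N^-1 * (N * (D * O)) by rewrite mulKr.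
  rewrite e -[X in eqm _ _ X](mulVr uN); apply: eqmM; first exact: eqm_refl.
  have le3 : (n <= 2 * n)%N by lia.
  rewrite (big_cat_nat (leq0n n) le3) /= -[X in eqm _ _ X]mulr1.
  apply: eqmM; first exact: eqm_refl.
  rewrite big_nat; elim/big_rec: _ => [|k a /andP[lenk _] IHa]; first exact: eqm_refl.
  rewrite mulrBl mul1r -[X in eqm _ _ X]addr0; apply: eqmD => //.
  by rewrite -mulrN; apply: eqm_lowM; [exact: q0 | lia].
apply: eqm_trans (eqmM hp (eqmX 2 hm)) _.
have uDO : D * O \is a GRing.unit by rewrite unitrM uD.
have -> : N * D / O * (N / D) ^+ 2 = N ^+ 3 * (D * O)^-1.
  rewrite invrM //; have := mulrV uD; move: (D^-1) (O^-1) => iD iO eD.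
  by transitivity (N ^+ 3 * (iO * iD) * (D * iD)); [ring | rewrite eD mulr1].
rewrite -[X in eqm _ _ X]mulr1 -[X in eqm _ _ (_ * X)](mulVr uDO).
rewrite -[X in eqm _ X _]mulr1 -mulrA; apply: eqmM; first exact: eqm_refl.
by apply: eqmM; [exact: eqm_refl | exact: eqm_sym].
Qed.

(** Even squares are 4 j^2 and odd squares are 8 j(j+1)/2 + 1, whence phi(q) = phi(q^4) + 2q
    psi(q^8). *)
Lemma thp_dissect : thp = fsq (fsq thp) + 2 * q * fsq (fsq (fsq psi)).
Proof.
rewrite /thp /psi !fsq_lac; try by move=> k; have := leq_tri k; nia.
rewrite -mulrA flac_shift; last by move=> k; have := leq_tri k; nia.
rewrite -(rmorph_nat (@fconst rat) 2) flacZ.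
rewrite {1}flac_split; last exact: leq_sqr.
congr (_ + _); apply: eq_flac => k /=; rewrite ?muln_eq0 ?mulr1 //.
  by nia.
by have := triE k; nia.
Qed.

Lemma thm_dissect : thm = fsq (fsq thp) - 2 * q * fsq (fsq (fsq psi)).
Proof.
rewrite /thm /thp /psi !fsq_lac; try by move=> k; have := leq_tri k; nia.
rewrite -!mulNr -mulrA flac_shift; last by move=> k; have := leq_tri k; nia.
rewrite -(rmorph_nat (@fconst rat) 2) -rmorphN flacZ.
rewrite {1}flac_split; last exact: leq_sqr.
have odd2 k : odd (2 * k) = false by rewrite oddM.
congr (_ + _); apply: eq_flac => k /=; rewrite /sqw ?muln_eq0 ?mulr1 //=.
- by rewrite -signr_odd odd2 expr0 mulr1.
- by nia.
- by rewrite exprS -signr_odd odd2 expr0 mulr1 mulrN1.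
by have := triE k; nia.
Qed.

Lemma thp_0 : thp 0%N = 1.
Proof. by rewrite fcoef_lac big_ord_recl big_ord0 /= addr0 mulr1. Qed.
Lemma thm_0 : thm 0%N = 1.
Proof. by rewrite fcoef_lac big_ord_recl big_ord0 /= addr0 mulr1. Qed.
Lemma psi_0 : psi 0%N = 1.
Proof. by rewrite fcoef_lac big_ord_recl big_ord0 /= addr0 mulr1. Qed.

(** By the dissection of phi and by [psi_sqr] at q^4, the defect D satisfies D(q) = -D(q^2), hence
    vanishes. *)
Lemma thp_sqr : thp ^+ 2 = fsq thp ^+ 2 + 4 * q * fsq (fsq psi) ^+ 2.
Proof.
pose D := thp ^+ 2 - fsq thp ^+ 2 - 4 * q * fsq (fsq psi) ^+ 2.
suff : D = 0 by rewrite /D -addrA -opprD => /eqP; rewrite subr_eq0 => /eqP.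
apply: (@fsq_fixed _ (- 1)).
  by rewrite /D !(fcoefB, fcoefX0, fcoefM0, fsq_coef0) thp_0 q0 mulr0 !mul0r !subrr.
have := congr1 (fun a => fsq (fsq a)) psi_sqr; rewrite !fsqXn !fsqM => e.
rewrite /D !fsqB !fsqXn [fsq (_ * _ * _)]fsqM [fsq (_ * q)]fsqM fsqXn fsqX fsq_nat.
by rewrite e {1}thp_dissect; ring.
Qed.

(** Passing from phi(q) to phi(-q) flips the sign of the odd part in the dissection, which changes
    the square by 8q psi(q^4)^2. *)
Lemma thm_sqr : thm ^+ 2 = fsq thp ^+ 2 - 4 * q * fsq (fsq psi) ^+ 2.
Proof.
have := congr1 (fun a => fsq (fsq a)) psi_sqr; rewrite !fsqXn !fsqM => e.
have := congr1 (fun a => a - 8 * q * fsq (fsq psi) ^+ 2) thp_sqr.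
rewrite {1}e {1}thp_dissect thm_dissect => e2.
transitivity (fsq thp ^+ 2 + 4 * q * fsq (fsq psi) ^+ 2 - 8 * q * fsq (fsq psi) ^+ 2).
  by rewrite -e2; ring.
by ring.
Qed.

(** * The modular parametrization *)

(* [16 * xq] is the modular lambda function and [theta] is theta_3^2. *)
Definition psi2 : fps rat := fsq psi.
Definition theta : fps rat := thp ^+ 2.
Definition xq : fps rat := q * psi2 ^+ 4 / theta ^+ 2.
Definition fdlog (a : fps rat) : fps rat := fder a / a.

Lemma psi2_0 : psi2 0%N = 1. Proof. by rewrite fsq_coef0 psi_0. Qed.
Lemma theta_0 : theta 0%N = 1. Proof. by rewrite fcoefX0 thp_0 expr1n. Qed.
Lemma xq_0 : xq 0%N = 0. Proof. by rewrite !fcoefM0 q0 !mul0r. Qed.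
Lemma psi2_unit : psi2 \is a GRing.unit. Proof. exact: funit1 psi2_0. Qed.
Lemma thp_unit : thp \is a GRing.unit. Proof. exact: funit1 thp_0. Qed.
Lemma theta_unit : theta \is a GRing.unit. Proof. exact: funit1 theta_0. Qed.
Lemma fsq_unit (a : fps rat) : a \is a GRing.unit -> fsq a \is a GRing.unit.
Proof. by rewrite !funitE fsq_coef0. Qed.

Lemma fdlogK a : a \is a GRing.unit -> fder a = a * fdlog a.
Proof. by move=> ua; rewrite /fdlog mulrC divrK. Qed.
Lemma fdlog_sq a : a \is a GRing.unit -> fdlog (fsq a) = 2 * fsq (fdlog a).
Proof. by move=> ua; rewrite /fdlog fder_sq fsqM fsqV // mulrA. Qed.

Lemma thp_thm_sq : fsq thm ^+ 4 = thp ^+ 2 * thm ^+ 2.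
Proof. by rewrite -exprMn thp_thm -exprM. Qed.

Lemma psi2_sqr : psi2 ^+ 2 = fsq psi2 * fsq thp.
Proof. by rewrite /psi2 -fsqXn psi_sqr fsqM. Qed.

(** The left side is the logarithmic derivative of [xq], so this is the classical formula for that
    of lambda as theta_4^4. The defect W satisfies phi(q)^2 W(q) = phi(-q)^2 W(q^2). *)
Lemma fdlog_theta : 1 + 4 * (fdlog psi2 - fdlog thp) = thm ^+ 4.
Proof.
pose W := 1 + 4 * (fdlog psi2 - fdlog thp) - thm ^+ 4.
suff : W = 0 by move/eqP; rewrite subr_eq0 => /eqP.
have W0 : W 0%N = 0.
  have d0 a : fdlog a 0%N = 0 by rewrite fcoefM0 fcoef_der !mul0r.
  rewrite fcoefB fcoefX0 thm_0 expr1n fcoefD fcoefM0 fcoefB !d0 fcoef1.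
  by rewrite subr0 ?mulr0 ?addr0 subrr.
have uA := fsq_unit thp_unit; have uC := fsq_unit psi2_unit.
have : thp ^+ 2 * W = thm ^+ 2 * fsq W.
  have fW : fsq W = 1 + 2 * (fdlog (fsq psi2) - fdlog (fsq thp)) - thp ^+ 2 * thm ^+ 2.
    rewrite /W fsqB fsqXn thp_thm_sq fsqD fsqM fsqB fsq1 fsq_nat.
    by rewrite (fdlog_sq psi2_unit) (fdlog_sq thp_unit); ring.
  (* [e1] and [e2] are the derivatives of [psi2_sqr] and [thp_sqr]; they express the logarithmic
     derivatives at q through those at q^2. *)
  have e1 : 2 * fdlog psi2 = fdlog (fsq psi2) + fdlog (fsq thp).
    have := congr1 (@fder _) psi2_sqr.
    rewrite fderXn fderM (fdlogK psi2_unit) (fdlogK uC) (fdlogK uA) expr1 => e.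
    apply: (@mulrI _ (psi2 ^+ 2)); first by rewrite unitrX ?psi2_unit.
    rewrite {2}psi2_sqr; transitivity (2 * psi2 * (psi2 * fdlog psi2)); first by ring.
    by rewrite e; ring.
  have e2 : thp ^+ 2 * (2 * fdlog thp) = 2 * fsq thp ^+ 2 * fdlog (fsq thp)
      + 4 * q * fsq psi2 ^+ 2 * (1 + 2 * fdlog (fsq psi2)).
    have := congr1 (@fder _) thp_sqr.
    rewrite -/psi2 fderD !fderXn [fder (_ * _ * _)]fderM [fder (_ * q)]fderM.
    rewrite fderXn fder_nat fderX !expr1.
    rewrite (fdlogK thp_unit) (fdlogK uA) (fdlogK uC) => e.
    transitivity (2 * thp * (thp * fdlog thp)); first by ring.
    by rewrite e; ring.
  rewrite fW /W.
  transitivity (thp ^+ 2 * (1 + 2 * (2 * fdlog psi2)) - 2 * (thp ^+ 2 * (2 * fdlog thp))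
     - thp ^+ 2 * thm ^+ 4); first by ring.
  rewrite e1 e2 thm_sqr thp_sqr -/psi2.
  have -> : thm ^+ 4 = (thm ^+ 2) ^+ 2 by ring.
  by rewrite thm_sqr -/psi2; ring.
move=> e; apply: (@fsq_fixed _ (thp ^- 2 * thm ^+ 2)) => //.
by rewrite -mulrA -e mulrA mulVr ?mul1r // unitrX ?thp_unit.
Qed.

(** Jacobi's identity theta_3^4 - theta_4^4 = theta_2^4: the factors phi(q)^2 - phi(-q)^2 and
    phi(q)^2 + phi(-q)^2 come from [thp_sqr] and [thm_sqr]. *)
Lemma thp4_sub : thp ^+ 4 - thm ^+ 4 = 16 * q * psi2 ^+ 4.
Proof.
have -> : thp ^+ 4 = (thp ^+ 2) ^+ 2 by ring.
have -> : thm ^+ 4 = (thm ^+ 2) ^+ 2 by ring.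
have -> : psi2 ^+ 4 = (psi2 ^+ 2) ^+ 2 by ring.
by rewrite thp_sqr thm_sqr psi2_sqr -/psi2; ring.
Qed.

Lemma xq_theta : xq * theta ^+ 2 = q * psi2 ^+ 4.
Proof. by rewrite divrK // unitrX ?theta_unit. Qed.

Lemma one_sub_xq : (1 - 16 * xq) * theta ^+ 2 = thm ^+ 4.
Proof.
rewrite mulrBl mul1r -mulrA xq_theta /theta -exprM; have := thp4_sub.
by move=> e; rewrite mulrA -e; ring.
Qed.

Lemma fder_xq : fder xq = xq * thm ^+ 4.
Proof.
apply: (@mulIr _ (theta ^+ 2)); first by rewrite unitrX ?theta_unit.
have := congr1 (@fder _) xq_theta.
rewrite [fder (_ * theta ^+ 2)]fderM [fder (q * _)]fderM fderX !fderXn.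
rewrite (fdlogK psi2_unit) (fdlogK thp_unit) -fdlog_theta.
move=> e; rewrite [RHS]mulrAC xq_theta.
transitivity (fder xq * theta ^+ 2 + xq * (2 * theta ^+ 1 * (2 * thp ^+ 1 * (thp * fdlog thp)))
  - 4 * fdlog thp * (xq * theta ^+ 2)); first by rewrite /theta; ring.
by rewrite e xq_theta; ring.
Qed.

(** The hypergeometric equation of F pulled back along [xq]: there the Euler operator in x is
    thm^(-4) times the one in q, and 1 - 16 x is thm^4 / theta^2. The defect satisfies theta(q) E(q)
    = 4 theta(q^2) E(q^2). *)
Lemma theta_ode : fder (fder theta / theta ^+ 2) = 4 * xq * thm ^+ 4 * theta.
Proof.
pose r := fder theta / theta ^+ 2.
pose E := fder r - 4 * xq * thm ^+ 4 * theta.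
suff : E = 0 by move/eqP; rewrite subr_eq0 => /eqP.
have E0 : E 0%N = 0.
  by rewrite fcoefB fcoef_der mul0r sub0r 3!fcoefM0 xq_0 mulr0 !mul0r oppr0.
(* All quantities are written in T, Z and s, with [theta = T + Z] and [thm ^+ 2 = T - Z]; s is twice
   r at q^2. *)
pose T := fsq theta; pose Z := 4 * q * fsq psi2 ^+ 2; pose s := fder T / T ^+ 2.
have uT : T \is a GRing.unit := fsq_unit theta_unit.
have uA := fsq_unit thp_unit; have uC := fsq_unit psi2_unit.
have TE : T = fsq thp ^+ 2 by rewrite /T fsqXn.
have thE : theta = T + Z by rewrite TE; apply: thp_sqr.
have bE : thm ^+ 2 = T - Z by rewrite TE; apply: thm_sqr.
have b4 : thm ^+ 4 = (T - Z) ^+ 2 by rewrite -bE; ring.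
have dT : fder T = s * T ^+ 2 by rewrite divrK // unitrX.
have dZ : fder Z = Z * (s * T + theta * (T - Z)).
  (* This is [fdlog_theta] at q^2, which supplies the logarithmic derivative of Z. *)
  have e3 : 1 + 2 * (fdlog (fsq psi2) - fdlog (fsq thp)) = theta * (T - Z).
    rewrite -bE -thp_thm_sq -fsqXn -fdlog_theta fsqD fsqM fsqB fsq1 fsq_nat.
    by rewrite (fdlog_sq psi2_unit) (fdlog_sq thp_unit); ring.
  have e4 : s * T = 2 * fdlog (fsq thp).
    apply: (mulIr uT); rewrite -mulrA -expr2 -dT TE fderXn (fdlogK uA); ring.
  rewrite e4 -e3 /Z [fder (_ * _ * _)]fderM fderXn [fder (_ * q)]fderM.
  by rewrite fder_nat fderX (fdlogK uC); ring.
have rE : theta * r = s * T + Z * (T - Z).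
  apply: (mulIr theta_unit).
  have d : r * theta ^+ 2 = fder theta by rewrite divrK // unitrX ?theta_unit.
  transitivity (r * theta ^+ 2); first by ring.
  by rewrite d [in LHS]thE fderD dT dZ thE; ring.
have dr : theta * fder r = T * fder s + Z * theta * (T - Z) ^+ 2
    - Z ^+ 2 * theta * (T - Z) - Z ^+ 2 * (T - Z) ^+ 2.
  have := congr1 (@fder _) rE; rewrite [fder (theta * r)]fderM fderD.
  rewrite [fder (s * T)]fderM [fder (Z * (_ - _))]fderM fderB dT dZ => e.
  have e5 : (s * T ^+ 2 + Z * (s * T + theta * (T - Z))) * r
      = (s * T + Z * (T - Z)) * (theta * r) by rewrite thE; ring.
  move: e; rewrite {1}thE fderD dT dZ e5 rE => e.
  transitivity ((s * T + Z * (T - Z)) * (s * T + Z * (T - Z)) + theta * fder r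
    - (s * T + Z * (T - Z)) * (s * T + Z * (T - Z))); first by ring.
  by rewrite e thE; ring.
have xE : 4 * xq * theta ^+ 2 = Z * T.
  rewrite -mulrA xq_theta.
  have -> : psi2 ^+ 4 = (psi2 ^+ 2) ^+ 2 by ring.
  by rewrite psi2_sqr TE /Z; ring.
have fr : 4 * fsq (fder r) = fder s.
  have -> : s = 2 * fsq r.
    have u2 : theta ^+ 2 \is a GRing.unit by rewrite unitrX ?theta_unit.
    by rewrite /r fsqM (fsqV u2) fsqXn mulrA -fder_sq.
  by rewrite fderM fder_nat fder_sq; ring.
have fx : T * (4 * fsq (4 * xq * thm ^+ 4 * theta)) = Z ^+ 2 * theta * (T - Z).
  have e6 : fsq xq * T ^+ 2 = q ^+ 2 * fsq psi2 ^+ 4.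
    by rewrite /T -[fsq theta ^+ 2]fsqXn -fsqM xq_theta [fsq (q * _)]fsqM fsqXn fsqX.
  rewrite 2!fsqM [fsq (4 * _)]fsqM fsq_nat fsqXn thp_thm_sq -/theta -/T bE.
  transitivity (16 * (fsq xq * T ^+ 2) * (theta * (T - Z))); first by ring.
  by rewrite e6 /Z; ring.
have EE : theta * E = (4 * T) * fsq E.
  rewrite /E fsqB mulrBr dr.
  transitivity (T * (4 * fsq (fder r)) - T * (4 * fsq (4 * xq * thm ^+ 4 * theta))); last by ring.
  rewrite fr fx b4.
  have -> : theta * (4 * xq * (T - Z) ^+ 2 * theta) = (4 * xq * theta ^+ 2) * (T - Z) ^+ 2 by ring.
  by rewrite xE thE; ring.
apply: (@fsq_fixed _ (theta^-1 * (4 * T))) => //.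
by rewrite -mulrA -EE mulKr ?theta_unit.
Qed.

(** * The eta product in terms of theta and x *)

Lemma heval_fX (K : fieldType) (P : {poly K}) n : heval fX P n = P`_n.
Proof.
rewrite (@heval_coef _ _ _ (maxn (size P) n.+1)) ?leq_maxl //.
rewrite (bigD1 (Ordinal (leq_maxr (size P) n.+1))) //= fcoefXn eqxx mulr1.
rewrite big1 ?addr0 // => k nk; rewrite fcoefXn; case: eqP => [e|]; rewrite ?mulr0 //.
by case/eqP: nk; apply: val_inj.
Qed.

(** eta^12(2z)/q is the fourth power of the cube in [eta_cube], taken at q^2. *)
Lemma gammaE n : (gamma n.+1)%:~R = (fsq (psi * thm ^+ 2) ^+ 4) n.
Proof.
have -> : (gamma n.+1)%:~R = heval q (map_poly intr (eta12_trunc n.+1)) n.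
  by rewrite heval_fX coef_map.
have -> : heval q (map_poly intr (eta12_trunc n.+1))
    = fsq ((\prod_(0 <= k < n.+1) (1 - q ^+ k.+1)) ^+ 3) ^+ 4.
  rewrite /heval /eta12_trunc !rmorph_prod horner_prod fsqXn -exprM fsq_prod.
  rewrite -prodrXl big_add1; apply: eq_bigr => k _; rewrite fsq_1Bq.
  by rewrite !rmorphXn !rmorphB !rmorph1 /= !map_polyXn !hornerE.
have len : (n.+1 <= 2 * n.+2)%N by lia.
exact: esym (eqm_coef (eqmX 4 (eqm_leq len (fsq_eqm (@eta_cube n.+1)))) (ltnSn n)).
Qed.

(** With [gammaE], this makes sum gamma(n) q^n equal to theta^4 q dx/dq; [thp_thm] turns phi(-q^2)^2
    into phi(q) phi(-q). *)
Lemma eta_theta : q * fsq (psi * thm ^+ 2) ^+ 4 = theta ^+ 4 * fder xq.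
Proof.
rewrite fsqM fsqXn -thp_thm -/psi2 fder_xq.
transitivity (xq * theta ^+ 2 * (theta ^+ 2 * thm ^+ 4)); last by ring.
by rewrite xq_theta /theta; ring.
Qed.

(** * The hypergeometric equation *)

Definition binsq n : rat := ('C(2 * n, n) ^ 2)%:R.
(* [hdiff n] is H_(2n) - H_n; [hypF * log X + hypG] is the second Frobenius
   solution of the equation of [hypF]. *)
Definition hdiff n : rat := \sum_(j < n) ((2 * j).+1%:R^-1 - (2 * j).+2%:R^-1).
Definition hypF : fps rat := Fps binsq.
Definition hypG : fps rat := Fps (fun n => 4 * binsq n * hdiff n).

Lemma fcoef_hypF n : hypF n = binsq n. Proof. by []. Qed.
Lemma fcoef_hypG n : hypG n = 4 * binsq n * hdiff n. Proof. by []. Qed.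

Lemma binsqS n : n.+1%:R ^+ 2 * binsq n.+1 = 4 * (2 * n).+1%:R ^+ 2 * binsq n.
Proof.
rewrite /binsq -!natrX -!natrM; congr (_%:R).
have e : (n.+1 * 'C(2 * n.+1, n.+1) = 2 * ((2 * n).+1 * 'C(2 * n, n)))%N.
  have -> : (2 * n.+1 = (2 * n).+2)%N by lia.
  rewrite -(mul_bin_diag (2 * n).+2 n) (mul_bin_down (2 * n).+1 n).
  have -> : ((2 * n).+1 - n = n.+1)%N by lia.
  by rewrite /=; lia.
by rewrite -expnMn e !expnMn; lia.
Qed.

Lemma natr_pred n : n%:R = n.+1%:R - 1 :> rat.
Proof. by rewrite -natr1 addrK. Qed.
Lemma natr_odd n : (2 * n).+1%:R = 2 * n.+1%:R - 1 :> rat.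
Proof. by rewrite -!natr1 natrM; ring. Qed.

(** Coefficientwise this is [binsqS], because 16 n(n+1) + 4 = 4 (2n+1)^2. *)
Lemma hypF_ode : fder ((1 - 16 * fX) * fder hypF) = 4 * fX * hypF.
Proof.
apply: fpsP => n; rewrite fcoef_der mulrBl mul1r fcoefB -!mulrA.
rewrite !fcoef_natM !fcoefXM.
case: n => [|n]; first by rewrite mul0r mulr0.
rewrite !fcoef_der fcoef_hypF; have := binsqS n.
rewrite !fcoef_hypF natr_odd (natr_pred n) => e.
transitivity (n.+1%:R ^+ 2 * binsq n.+1 - 16 * n.+1%:R * (n.+1%:R - 1) * binsq n).
  by ring.
by rewrite e; ring.
Qed.

Lemma hdiffS n : hdiff n.+1 = hdiff n + ((2 * n).+1%:R^-1 - (2 * n).+2%:R^-1).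
Proof. by rewrite /hdiff big_ord_recr. Qed.

(** The terms beyond 4 X G are what the operator leaves of F log X once the multiple of log X
    cancels by [hypF_ode]. *)
Lemma hypG_ode : fder ((1 - 16 * fX) * fder hypG)
  = 4 * fX * hypG + 32 * fX * fder hypF + 16 * fX * hypF - 2 * fder hypF.
Proof.
apply: fpsP => n; rewrite fcoef_der mulrBl mul1r fcoefB.
rewrite [in RHS]fcoefB 2!fcoefD -![_ * fX * _]mulrA.
rewrite !fcoef_natM !fcoefXM !fcoef_der.
case: n => [|n]; first by rewrite !(mul0r, mulr0, addr0, subr0).
rewrite !fcoef_der !fcoef_hypF !fcoef_hypG hdiffS; have := binsqS n.
have n1 : (2 * n).+1%:R != 0 :> rat by rewrite pnatr_eq0.
have n2 : n.+1%:R != 0 :> rat by rewrite pnatr_eq0.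
have -> : (2 * n).+2%:R = 2 * n.+1%:R :> rat by rewrite -natrM; congr (_%:R); lia.
move: n1; rewrite natr_odd (natr_pred n) => n1.
move: n1; move: n.+1%:R n2 (binsq n.+1) (binsq n) (hdiff n).
move=> m m0 b' b d m1 e.
have -> : b' = 4 * (2 * m - 1) ^+ 2 * b / m ^+ 2.
  by rewrite -e mulrC mulKf // expf_neq0.
by field; rewrite m0 m1.
Qed.

Lemma fder_eq0 (a : fps rat) : fder a = 0 -> a = fconst (a 0%N).
Proof.
move=> da; apply: fpsP => -[|n] //; move/(congr1 (fun b : fps rat => b n.+1)): da.
by rewrite fcoef_der fcoef0 => /eqP; rewrite mulf_eq0 pnatr_eq0 /= => /eqP.
Qed.

(** The second factor is the Wronskian of F and F log X + G; its product with 1 - 16 X has zero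
    derivative and constant term 1. *)
Lemma hyp_wronskian :
  (1 - 16 * fX) * (hypF * fder hypG - hypG * fder hypF + hypF ^+ 2) = 1.
Proof.
set W := LHS.
have F0 : hypF 0%N = 1 by rewrite fcoef_hypF /binsq bin0.
have G0 : hypG 0%N = 0 by rewrite fcoef_hypG /hdiff big_ord0 mulr0.
have W0 : W 0%N = 1.
  rewrite /W fcoefM0 fcoefB fcoef1 fcoefM0 mulr0 subr0 fcoefD fcoefX0 fcoefB 2!fcoefM0.
  by rewrite !fcoef_der F0 G0 !(mul0r, mulr0) subrr add0r expr1n mulr1.
have -> : 1 = fconst (W 0%N) by rewrite W0 rmorph1.
apply: fder_eq0.
have -> : W = hypF * ((1 - 16 * fX) * fder hypG) - hypG * ((1 - 16 * fX) * fder hypF)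
    + (1 - 16 * fX) * hypF ^+ 2 by rewrite /W; ring.
have d16 : fder (1 - 16 * fX) = - (16 * fX) :> fps rat.
  by rewrite fderB fder1 sub0r fderM fder_nat fderX mul0r add0r.
rewrite fderD fderB [fder (hypF * _)]fderM [fder (hypG * _)]fderM hypF_ode hypG_ode.
rewrite [fder (_ * hypF ^+ 2)]fderM fderXn d16; ring.
Qed.

(** Since v(0) = 1 and w(0) = 0, the equation at index n expresses n^2 Y_n through lower
    coefficients. *)
Lemma ode_unique (v w Y : fps rat) : v 0%N = 1 -> w 0%N = 0 -> Y 0%N = 0 ->
  fder (v * fder Y) = w * Y -> Y = 0.
Proof.
move=> v0 w0 Y0 ode; apply: fpsP => n; rewrite fcoef0.
elim/ltn_ind: n => -[//|n] IHn.
have := congr1 (fun a : fps rat => a n.+1) ode.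
rewrite fcoef_der !fcoefM big_ord_recl [in RHS]big_ord_recl v0 w0 mul0r add0r.
rewrite mul1r subn0 fcoef_der !big1 ?addr0.
- move/eqP; rewrite !mulf_eq0 !pnatr_eq0 /=; move/eqP; exact.
- by move=> i _; rewrite IHn ?mulr0 // lift0; lia.
by move=> i _; rewrite fcoef_der IHn ?mulr0 // lift0; lia.
Qed.

(** Both sides start with 1 and solve the same equation in q: theta by [theta_ode], F(x) by the
    chain rule and [hypF_ode]. *)
Lemma theta_hypF : fcomp xq hypF = theta.
Proof.
apply/eqP; rewrite -subr_eq0; apply/eqP.
have th20 : theta ^+ 2 \is a GRing.unit by rewrite unitrX ?theta_unit.
apply: (@ode_unique (theta ^- 2) (4 * xq * thm ^+ 4)).
- by rewrite fcoefV0 fcoefX0 theta_0 expr1n ?invr1.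
- by rewrite 2!fcoefM0 xq_0 mulr0 mul0r.
- by rewrite fcoefB fcoef_comp0 theta_0 fcoef_hypF /binsq bin0 subrr.
rewrite fderB mulrBr fderB mulrBr -theta_ode [theta ^- 2 * fder theta]mulrC.
congr (_ - _); rewrite (fder_comp _ xq_0 fder_xq).
have -> : theta ^- 2 * (fcomp xq (fder hypF) * thm ^+ 4)
    = fcomp xq ((1 - 16 * fX) * fder hypF).
  rewrite -one_sub_xq fcompM ?xq_0 // fcompB fcomp1 fcompM ?xq_0 // fcomp_nat.
  rewrite fcompX ?xq_0 //; have := mulrV th20; move: (theta ^- 2) => it uit.
  transitivity ((1 - 16 * xq) * fcomp xq (fder hypF) * (theta ^+ 2 * it)); first by ring.
  by rewrite uit mulr1.
rewrite (fder_comp _ xq_0 fder_xq) hypF_ode !fcompM ?xq_0 // fcomp_nat fcompX ?xq_0 //.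
by ring.
Qed.

(* [logL] is log (q / xq). *)
Definition logL : fps rat := Fps (fun n => - (thm ^+ 4) n / n%:R).

Lemma fder_logL : fder logL = 1 - thm ^+ 4.
Proof.
apply: fpsP => -[|n]; rewrite fcoef_der fcoefB fcoef1.
  by rewrite mul0r fcoefX0 thm_0 expr1n subrr.
by rewrite /= sub0r mulrC divfK // pnatr_eq0.
Qed.

(** Division by zero yields 0 here, which is the right value: q / x starts with 1. *)
Lemma logL_0 : logL 0%N = 0.
Proof. by rewrite /= invr0 mulr0. Qed.

(** The Wronskian pulled back along [xq] shows that G(x)/theta and [logL] have the same derivative;
    both vanish at q = 0. *)
Lemma theta_hypG : fcomp xq hypG = theta * logL.
Proof.
have e0 : (1 - 16 * xq) * (theta * fcomp xq (fder hypG)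
    - fcomp xq hypG * fcomp xq (fder hypF) + theta ^+ 2) = 1.
  have := congr1 (fcomp xq) hyp_wronskian.
  rewrite fcompM ?xq_0 // fcomp1 fcompB fcomp1 [fcomp xq (16 * _)]fcompM ?xq_0 //.
  rewrite fcomp_nat fcompX ?xq_0 // fcompD fcompB fcompXn ?xq_0 //.
  rewrite [fcomp xq (hypF * _)]fcompM ?xq_0 // [fcomp xq (hypG * _)]fcompM ?xq_0 //.
  by rewrite theta_hypF.
have dF := fder_comp hypF xq_0 fder_xq; have dG := fder_comp hypG xq_0 fder_xq.
rewrite theta_hypF in dF.
have e : theta * fder (fcomp xq hypG) - fcomp xq hypG * fder theta
    = theta ^+ 2 * fder logL.
  rewrite fder_logL dF dG; move: (fcomp _ _) (fcomp _ _) (fcomp _ _) e0 => Fd Gx Gd e0.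
  transitivity (((1 - 16 * xq) * theta ^+ 2) * (theta * Gd - Gx * Fd + theta ^+ 2)
    - thm ^+ 4 * theta ^+ 2); first by rewrite one_sub_xq; ring.
  rewrite mulrAC e0; ring.
have := mulrV theta_unit; have := fderV theta_unit.
move: (theta^-1) => it dit uit.
suff e1 : fcomp xq hypG * it - logL = 0.
  transitivity ((fcomp xq hypG * it - logL) * theta + fcomp xq hypG * (1 - theta * it)
    + theta * logL); first by ring.
  by rewrite e1 uit subrr mulr0 mul0r !add0r.
have -> : 0 = fconst ((fcomp xq hypG * it - logL) 0%N).
  rewrite fcoefB fcoefM0 fcoef_comp0 logL_0 fcoef_hypG /hdiff big_ord0.
  by rewrite mulr0 mul0r subrr rmorph0.
apply: fder_eq0; rewrite fderB fderM dit.
transitivity (it ^+ 2 * (theta * fder (fcomp xq hypG) - fcomp xq hypG * fder theta)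
  - fder logL + fder (fcomp xq hypG) * it * (1 - theta * it)); first by ring.
rewrite e uit subrr mulr0 addr0.
transitivity (((theta * it) ^+ 2 - 1) * fder logL); first by ring.
by rewrite uit expr1n subrr mul0r.
Qed.

(** * Congruences between p-integral rationals *)

Section PIntegral.
Variable p : nat.
Hypothesis pp : prime p.
Notation P := (p%:R : rat).

(** The localization of the integers at p; d = 0 is excluded because it is not coprime to a
    prime. *)
Definition pint (r : rat) := exists m : int, exists d : nat,
  coprime p d /\ r * d%:R = m%:~R.

Lemma pint_int (m : int) : pint m%:~R.
Proof. by exists m, 1%N; rewrite coprimen1 mulr1. Qed.
Lemma pint_nat (n : nat) : pint n%:R.
Proof. exact: (pint_int n%:Z). Qed.
Lemma pint0 : pint 0. Proof. exact: (pint_nat 0). Qed.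
Lemma pint1 : pint 1. Proof. exact: (pint_nat 1). Qed.
Lemma pintN r : pint r -> pint (- r).
Proof. by move=> [m [d [cd e]]]; exists (- m), d; rewrite mulNr e rmorphN. Qed.
Lemma pintD r s : pint r -> pint s -> pint (r + s).
Proof.
move=> [m [d [cd e]]] [m' [d' [cd' e']]].
exists (m * d'%:Z + m' * d%:Z), (d * d')%N; split; first by rewrite coprimeMr cd.
rewrite natrM rmorphD !rmorphM /= -e -e' -!pmulrn; ring.
Qed.
Lemma pintB r s : pint r -> pint s -> pint (r - s).
Proof. by move=> pr ps; apply: pintD => //; apply: pintN. Qed.
Lemma pintM r s : pint r -> pint s -> pint (r * s).
Proof.
move=> [m [d [cd e]]] [m' [d' [cd' e']]].
exists (m * m'), (d * d')%N; split; first by rewrite coprimeMr cd.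
by rewrite natrM rmorphM /= -e -e'; ring.
Qed.
Lemma pintX r n : pint r -> pint (r ^+ n).
Proof.
move=> pr; elim: n => [|n IHn]; first exact: pint1.
by rewrite exprS; apply: pintM.
Qed.
Lemma pint_sum I (r : seq I) (Q : pred I) (E : I -> rat) :
  (forall i, Q i -> pint (E i)) -> pint (\sum_(i <- r | Q i) E i).
Proof. by move=> pE; elim/big_ind: _ => //; [exact: pint0 | exact: pintD]. Qed.
Lemma pintV n : coprime p n -> pint n%:R^-1.
Proof.
move=> cn; exists 1, n; split=> //; rewrite mulVf // pnatr_eq0.
by apply/eqP => n0; move: cn (pp); rewrite n0 /coprime gcdn0 => /eqP ->.
Qed.
Lemma coprime_small n : (0 < n < p)%N -> coprime p n.
Proof.
by move=> /andP[n0 np]; rewrite prime_coprime // gtnNdvd.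
Qed.
Lemma pintV_small n : (0 < n < p)%N -> pint n%:R^-1.
Proof. by move=> /coprime_small; apply: pintV. Qed.
Lemma P_neq0 : P != 0. Proof. by rewrite pnatr_eq0 -lt0n prime_gt0. Qed.

Lemma coprime_fact n : (n < p)%N -> coprime p n`!.
Proof.
elim: n => [|n IHn] np; first by rewrite coprimen1.
by rewrite factS coprimeMr coprime_small ?IHn // ltnW.
Qed.

Definition pcong r s := pint ((r - s) / P ^+ 2).

Lemma pcongP r s : pcong r s <-> exists2 t, pint t & r = s + P ^+ 2 * t.
Proof.
have P2 : P ^+ 2 != 0 by rewrite expf_neq0 ?P_neq0.
split=> [h|[t pt ->]]; last by rewrite /pcong addrC addKr mulrC mulKf.
by exists ((r - s) / P ^+ 2) => //; rewrite mulrC divfK // addrC subrK.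
Qed.
Lemma pcong_refl r : pcong r r.
Proof. by rewrite /pcong subrr mul0r; apply: pint0. Qed.
Lemma pcong_sym r s : pcong r s -> pcong s r.
Proof. by rewrite /pcong -opprB mulNr => /pintN; rewrite opprK. Qed.
Lemma pcong_trans s r t : pcong r s -> pcong s t -> pcong r t.
Proof.
rewrite /pcong => h1 h2; have -> : r - t = (r - s) + (s - t) by rewrite addrA subrK.
by rewrite mulrDl; apply: pintD.
Qed.
Lemma pcongD r s r' s' : pcong r r' -> pcong s s' -> pcong (r + s) (r' + s').
Proof.
move=> h1 h2; rewrite /pcong opprD addrACA mulrDl; exact: pintD.
Qed.
Lemma pcongM r s r' s' : pint r' -> pint s -> pcong r r' -> pcong s s' ->
  pcong (r * s) (r' * s').
Proof.
move=> pr ps h1 h2; rewrite /pcong.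
have -> : (r * s - r' * s') / P ^+ 2
    = (r - r') / P ^+ 2 * s + r' * ((s - s') / P ^+ 2) by ring.
by apply: pintD; apply: pintM.
Qed.
Lemma pcong_pint r s : pcong r s -> pint s -> pint r.
Proof.
by move=> /pcongP[t pt ->] ps; apply: pintD => //; apply/pintM/pt/pintX/pint_nat.
Qed.
Lemma pcong_sum I (r : seq I) (Q : pred I) (E E' : I -> rat) :
  (forall i, Q i -> pcong (E i) (E' i)) ->
  pcong (\sum_(i <- r | Q i) E i) (\sum_(i <- r | Q i) E' i).
Proof. by move=> pE; elim/big_ind2: _ => //; [exact: pcong_refl | by move=> *; apply: pcongD].
Qed.

(** The denominator of the quotient is prime to p^2, so it can be cancelled from the divisibility in
    the integers. *)
Lemma pcong_int (m n : int) : pcong m%:~R n%:~R -> (m = n %[mod (p ^ 2)%:Z])%Z.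
Proof.
move=> /pcongP[t [k [d [cd e]]] h]; apply/eqP; rewrite eqz_mod_dvd.
have e2 : (m - n) * d%:Z = (p ^ 2)%:Z * k.
  apply: (@intr_inj rat); rewrite !intrM intrB h -!pmulrn natrX -e; ring.
have: ((p ^ 2)%:Z %| (m - n) * d%:Z)%Z by rewrite e2 dvdz_mulr.
by rewrite Gauss_dvdzl // coprimezE !absz_nat coprimeXl.
Qed.

(** The bound is applied with N = p: below that index the divisions by n caused by integration keep
    p-integrality. *)
Definition pints N (a : fps rat) := forall n, (n < N)%N -> pint (a n).

Lemma pintsB N a b : pints N a -> pints N b -> pints N (a - b).
Proof. by move=> pa pb n nN; apply: pintB; [apply: pa | apply: pb]. Qed.
Lemma pintsM N a b : pints N a -> pints N b -> pints N (a * b).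
Proof.
move=> pa pb n nN; rewrite fcoefM; apply: pint_sum => i _.
apply: pintM; last exact: pb (leq_ltn_trans (leq_subr _ _) nN).
by apply: pa; apply: leq_ltn_trans nN; rewrite -ltnS.
Qed.
Lemma pintsX N a m : pints N a -> pints N (a ^+ m).
Proof.
move=> pa; elim: m => [|m IHm]; last by rewrite exprS; apply: pintsM.
by move=> n _; rewrite expr0 fcoef1; apply: pint_nat.
Qed.

Definition pcongs N (a b : fps rat) := forall n, (n < N)%N -> pcong (a n) (b n).

Lemma pcongsM N a b a' b' : pints N a' -> pints N b -> pcongs N a a' -> pcongs N b b' ->
  pcongs N (a * b) (a' * b').
Proof.
move=> pa pb ha hb n nN; rewrite !fcoefM; apply: pcong_sum => i _.
have lei : (i < N)%N by apply: leq_ltn_trans nN; rewrite -ltnS.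
have lei' := leq_ltn_trans (leq_subr i n) nN.
by apply: pcongM; [apply: pa | apply: pb | apply: ha | apply: hb].
Qed.

End PIntegral.

Definition int_series (a : fps rat) := forall n, a n \is a Num.int.

Lemma int_seriesM a b : int_series a -> int_series b -> int_series (a * b).
Proof. by move=> ia ib n; rewrite fcoefM rpred_sum // => i _; rewrite rpredM. Qed.

Lemma int_thm4 : int_series (thm ^+ 4).
Proof.
have i1 : int_series thm.
  move=> n; rewrite fcoef_lac rpred_sum // => i _; rewrite rpredM ?rpred_nat // /sqw.
  by case: ifP => _; rewrite ?rpred1 // rpredM ?rpred_nat // rpredX // rpredN rpred1.
by move=> n; rewrite !exprS expr0 mulr1; do 3!apply: int_seriesM => //.
Qed.

Lemma pint_Num_int p r : r \is a Num.int -> pint p r.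
Proof. by case/intrP => m ->; apply: pint_int. Qed.

(** * The residue computation *)

Definition uq : fps rat := psi2 ^+ 4 / theta ^+ 2.

Lemma xqE : xq = q * uq. Proof. by rewrite /xq /uq mulrA. Qed.
Lemma uq_0 : uq 0%N = 1.
Proof.
by rewrite fcoefM0 fcoefX0 psi2_0 fcoefV0 fcoefX0 theta_0 !expr1n ?invr1 ?mulr1.
Qed.
Lemma uq_unit : uq \is a GRing.unit. Proof. exact: funit1 uq_0. Qed.
Lemma uqV_0 : uq^-1 0%N = 1.
Proof. by rewrite fcoefV0 uq_0 ?invr1 ?oner_neq0. Qed.

Lemma fX_inj : injective (fun a : fps rat => q * a).
Proof.
move=> a b e; apply: fpsP => n; move/(congr1 (fun c : fps rat => c n.+1)): e.
by rewrite !fcoefXM.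
Qed.

Lemma fder_xqE : fder xq = q * (uq + fder uq).
Proof. by rewrite xqE fderM fderX mulrDr. Qed.

(** The relation u = exp(-logL) in differential form, where x = q u. *)
Lemma fder_uq : fder uq = - (uq * fder logL).
Proof.
have: q * (uq + fder uq) = q * (uq * thm ^+ 4).
  by rewrite -fder_xqE fder_xq xqE mulrA.
move/fX_inj => e; rewrite fder_logL.
transitivity (uq + fder uq - uq); first by ring.
by rewrite e; ring.
Qed.

(** This is the residue of x^(-n-1) dx. For n > 0 the series is u^(-n) minus 1/n times the Euler
    derivative of u^(-n), and these agree at index n. *)
Lemma residue_uq n : (uq^-1 ^+ n.+1 * (uq + fder uq)) n = (n == 0%N)%:R.
Proof.
have uV := mulVr uq_unit.
have -> : uq^-1 ^+ n.+1 * (uq + fder uq) = uq^-1 ^+ n + uq^-1 ^+ n.+1 * fder uq.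
  by rewrite mulrDr exprSr -[_ * _ * uq]mulrA uV mulr1.
case: n => [|n]; first by rewrite fcoefD expr0 fcoef1 fcoefM0 fcoef_der mul0r mulr0 addr0.
have := congr1 (fun a : fps rat => a n.+1) (fderXn uq^-1 n).
rewrite fcoef_der fderV ?uq_unit // fcoefD.
have -> : n.+1%:R * uq^-1 ^+ n * - (uq^-1 ^+ 2 * fder uq)
    = n.+1%:R * (- (uq^-1 ^+ n.+2 * fder uq)) by rewrite !exprS; ring.
rewrite fcoef_natM fcoefN => /mulfI -> //; last by rewrite pnatr_eq0.
by rewrite addNr.
Qed.

(** The coefficient K_m is the residue of K(x) x^(-m-1) dx computed in q. After truncating K, the
    term x^k reduces to [residue_uq] at m - k. *)
Lemma residue_comp (K : fps rat) m :
  (fcomp xq K * fder xq * uq^-1 ^+ m.+1) m.+1 = K m.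
Proof.
have -> : fcomp xq K * fder xq * uq^-1 ^+ m.+1
    = q * (fcomp xq K * ((uq + fder uq) * uq^-1 ^+ m.+1)) by rewrite fder_xqE; ring.
rewrite fcoefXM.
rewrite (eqm_coef (eqmM (fcomp_eqm xq_0 m.+1 K) (eqm_refl _ _)) (ltnSn m)).
rewrite /heval (@horner_coef_wide _ m.+1); last first.
  by apply: leq_trans (size_poly _ _) (size_poly _ _).
have term k : (k <= m)%N ->
    (xq ^+ k * ((uq + fder uq) * uq^-1 ^+ m.+1)) m = (k == m)%:R.
  move=> lekm; have -> : m.+1 = (k + (m - k).+1)%N by lia.
  have -> : xq ^+ k * ((uq + fder uq) * uq^-1 ^+ (k + (m - k).+1))
      = q ^+ k * ((uq / uq) ^+ k * (uq^-1 ^+ (m - k).+1 * (uq + fder uq))).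
    by rewrite xqE !exprMn exprD; ring.
  rewrite mulrV ?uq_unit // expr1n mul1r fcoefXnM ltnNge lekm residue_uq.
  by rewrite subn_eq0 eqn_leq lekm.
rewrite mulr_suml fcoef_sum (bigD1 ord_max) // big1 => [|k nk].
  rewrite [LHS]addr0 coef_map coef_ftrunc // -mulrA fcoefCM term // eqxx.
  exact: mulr1.
have lek : (k <= m)%N by rewrite -ltnS.
rewrite coef_map -mulrA fcoefCM (term _ lek).
by case: eqP => [e|]; rewrite ?mulr0 //; case/eqP: nk; apply: val_inj.
Qed.

Section EtaCongruence.
Variable p : nat.
Hypothesis pp : prime p.
Notation P := (p%:R : rat).
(** V = (q/x)^p = exp(p logL). It is expanded as V = 1 + p W and W = logL + p E, with W and E
    p-integral below index p. *)
Let V : fps rat := uq^-1 ^+ p.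

Lemma fder_V : fder V = p%:R * V * fder logL.
Proof.
rewrite /V -(prednK (prime_gt0 pp)) fderXn fderV ?uq_unit // fder_uq.
have := mulVr uq_unit; move: (uq^-1) => iu e.
transitivity (p.-1.+1%:R * iu ^+ p.-1 * iu * (iu * uq) * fder logL); first by ring.
by rewrite e [iu ^+ p.-1.+1]exprS; ring.
Qed.

Lemma V_0 : V 0%N = 1. Proof. by rewrite fcoefX0 uqV_0 expr1n. Qed.

Let dL n : pint p (fder logL n).
Proof.
rewrite fder_logL fcoefB fcoef1; apply: pintB; first exact: pint_nat.
exact: pint_Num_int (int_thm4 n).
Qed.
Let dL0 : fder logL 0%N = 0. Proof. by rewrite fcoef_der mul0r. Qed.

Lemma pint_logL : pints p p logL.
Proof.
move=> [|n] np; first by rewrite logL_0; apply: pint0.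
have -> : logL n.+1 = n.+1%:R^-1 * fder logL n.+1.
  by rewrite fcoef_der mulKf // pnatr_eq0.
by apply: pintM => //; apply: pintV_small.
Qed.

Let W : fps rat := fconst P^-1 * (V - 1).
Let VE : V = 1 + p%:R * W.
Proof.
rewrite /W -[p%:R](rmorph_nat (@fconst rat)) mulrA -rmorphM divff ?P_neq0 //.
by rewrite rmorph1 mul1r addrC subrK.
Qed.

Let W_rec n : n%:R * W n = (V * fder logL) n.
Proof.
apply: (mulfI (P_neq0 pp)); rewrite -[RHS]fcoef_natM.
rewrite [p%:R * (V * fder logL)]mulrA -fder_V.
rewrite VE fderD fder1 add0r fderM fder_nat mul0r add0r fcoef_natM fcoef_der.
by [].
Qed.

Let W0 : W 0%N = 0. Proof. by rewrite fcoefCM fcoefB V_0 fcoef1 subrr mulr0. Qed.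

Let pintW : pints p p W.
Proof.
move=> n; elim/ltn_ind: n => -[|n] IHn np; first by rewrite W0; apply: pint0.
have -> : W n.+1 = n.+1%:R^-1 * (V * fder logL) n.+1.
  by rewrite -W_rec mulKf // pnatr_eq0.
apply: pintM; first exact: pintV_small.
(* The term that would involve [W n.+1] itself is multiplied by the constant coefficient of
   [fder logL], which is 0. *)
rewrite fcoefM; apply: pint_sum => i _; case: (ltnP i n.+1) => ltin; last first.
  have -> : (n.+1 - i = 0)%N by lia.
  by rewrite dL0 mulr0; apply: pint0.
apply: pintM => //; rewrite VE fcoefD fcoef1 fcoef_natM.
apply: pintD; first exact: pint_nat.
apply: pintM; first exact: pint_nat.
by apply: IHn; lia.
Qed.

Let E : fps rat := fconst P^-1 * (W - logL).
Let EE : W - logL = p%:R * E.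
Proof.
by rewrite /E -[p%:R](rmorph_nat (@fconst rat)) mulrA -rmorphM divff ?P_neq0 ?rmorph1 ?mul1r.
Qed.

(** The derivative of W - logL is (V - 1) times that of logL, hence p W times it, so n E_n is a
    coefficient of [W * fder logL]. *)
Let pintE : pints p p E.
Proof.
move=> [|n] np; first by rewrite fcoefCM fcoefB W0 logL_0 subrr mulr0; apply: pint0.
have -> : E n.+1 = n.+1%:R^-1 * (W * fder logL) n.+1.
  have n0 : n.+1%:R != 0 :> rat by rewrite pnatr_eq0.
  apply: (mulfI n0); rewrite mulVKf // fcoefCM fcoefB mulrCA mulrBr W_rec -fcoef_der.
  rewrite {1}VE mulrDl mul1r fcoefD addrC addKr -mulrA fcoef_natM mulKf //.
  exact: P_neq0.
apply: pintM; first exact: pintV_small.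
rewrite fcoefM; apply: pint_sum => i _.
case: (ltnP i n.+1) => ltin; first by apply: pintM => //; apply: pintW; lia.
have -> : (n.+1 - i = 0)%N by lia.
by rewrite dL0 mulr0; apply: pint0.
Qed.

(** For K = F^4 - p F^3 G, K(x) = theta^4 (1 - p logL), and V (1 - p logL) = 1 + p^2 (E - W logL).
    The residue of K(x) x^(-p) dx is thus gamma(p) up to p^2. *)
Lemma gamma_pcong :
  pcong p (gamma p)%:~R ((hypF ^+ 4 - p%:R * hypF ^+ 3 * hypG) p.-1).
Proof.
have pK := prednK (prime_gt0 pp).
set K := _ - _; rewrite -(residue_comp K p.-1) pK -/V.
have fK : fcomp xq K * fder xq * V
    = q * (fsq (psi * thm ^+ 2) ^+ 4 * (1 + p%:R ^+ 2 * (E - W * logL))).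
  rewrite [RHS]mulrA eta_theta.
  have -> : 1 + p%:R ^+ 2 * (E - W * logL) = V * (1 - p%:R * logL) :> fps rat.
    transitivity (1 + p%:R * (p%:R * E) - p%:R ^+ 2 * W * logL); first by ring.
    by rewrite -EE VE; ring.
  rewrite /K fcompB fcompXn ?xq_0 // [fcomp xq (_ * hypG)]fcompM ?xq_0 //.
  rewrite [fcomp xq (p%:R * _)]fcompM ?xq_0 // fcompXn ?xq_0 // fcomp_nat.
  rewrite theta_hypF theta_hypG.
  by ring.
have qp (Y : fps rat) : (q * Y) p = Y p.-1 by rewrite -{1}pK fcoefXM.
rewrite fK qp mulrDr mulr1 fcoefD -gammaE pK; apply: pcong_sym.
apply/(pcongP pp); set e := fsq _ ^+ 4.
exists ((e * (E - W * logL)) p.-1).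
  have h : pints p p (e * (E - W * logL)).
    apply: pintsM; first by move=> n _; rewrite /e -gammaE; apply: pint_int.
    by apply: pintsB => //; apply: pintsM => //; apply: pint_logL.
  by apply: h; rewrite pK.
congr (_ + _); rewrite -natrX mulrCA fcoef_natM natrX; ring.
Qed.

End EtaCongruence.

(** * Reduction of the hypergeometric coefficients *)

Section Apery.
Variable p : nat.
Hypothesis pp : prime p.
Hypothesis odd_p : odd p.
Notation P := (p%:R : rat).
Let h := p.-1./2.
Let hE : p = (2 * h).+1. Proof. by have := prime_gt0 pp; rewrite /h; lia. Qed.

Definition bterm (m k : nat) : nat := ('C(m, k) * 'C(m + k, k))%N.
Notation U k := ((bterm h k)%:R : rat).

Lemma bterm_rec m k :
  (k.+1 ^ 2 * bterm m k.+1 = (m - k) * (m + k).+1 * bterm m k)%N.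
Proof.
rewrite /bterm expnS expn1 mulnACA (mul_bin_left m k) addnS.
by rewrite -(mul_bin_diag (m + k).+1 k) /= mulnACA.
Qed.

Let h2 : 2 * h%:R = P - 1 :> rat.
Proof. by rewrite [in RHS]hE -natrM -natr1 addrK. Qed.

(** As 2h = p - 1, the factor (h - k)(h + k + 1) equals (p^2 - (2k+1)^2)/4; modulo p^2 this is the
    recurrence of [binsq] divided by -16. *)
Let U_recr k : k.+1%:R ^+ 2 * U k.+1 = (P ^+ 2 - (2 * k).+1%:R ^+ 2) / 4 * U k.
Proof.
rewrite -natrX -natrM bterm_rec 2!natrM.
have -> : (h + k).+1%:R = h%:R + k%:R + 1 :> rat by rewrite -natr1 natrD.
have -> : (2 * k).+1%:R = 2 * k%:R + 1 :> rat by rewrite -natr1 natrM.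
have -> : P = 2 * h%:R + 1 by rewrite h2 subrK.
(* For k > h the natural subtraction h - k is truncated, but then U k = 0. *)
case: (leqP k h) => [lekh|ltkh]; first by rewrite natrB //; field.
by rewrite /bterm bin_small ?mul0n ?mulr0.
Qed.

Let pint_n n := pint_nat p n.
Let pint_half : pint p 2^-1.
Proof.
apply: pintV => //; apply: coprime_small => //; have := prime_gt1 pp.
by case: (p) odd_p => [|[|[|]]].
Qed.
Let pint_16 : pint p (-16)^-1.
Proof.
have -> : (-16)^-1 = - (2^-1 ^+ 4) :> rat by field.
by apply: pintN; apply: pintX.
Qed.

Lemma binsq_pcong k : (k < p)%N -> pcong p (binsq k) ((-16) ^+ k * U k).
Proof.
elim: k => [|k IHk] kp.
  by rewrite /binsq /bterm !bin0 mulr1; apply: pcong_refl.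
have /(pcongP pp)[t pt e] := IHk (ltnW kp).
have k0 : k.+1%:R != 0 :> rat by rewrite pnatr_eq0.
apply/(pcongP pp).
(* The first summand propagates the error t, the second comes from the p^2 term of [U_recr]. *)
exists (k.+1%:R^-1 ^+ 2 * (4 * (2 * k).+1%:R ^+ 2 * t + 4 * ((-16) ^+ k * U k))).
  apply: pintM; first by apply/pintX/pintV_small.
  apply: pintD; apply: pintM => //; try exact: pint_n.
    by rewrite -natrX -natrM; exact: pint_n.
  by apply: pintM; [apply: pintX; apply: pintN|]; exact: pint_n.
have -> : binsq k.+1 = k.+1%:R^-1 ^+ 2 * (4 * (2 * k).+1%:R ^+ 2 * binsq k).
  by rewrite -binsqS exprVn mulKf // expf_neq0.
have -> : U k.+1 = k.+1%:R^-1 ^+ 2 * ((P ^+ 2 - (2 * k).+1%:R ^+ 2) / 4 * U k).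
  by rewrite -U_recr exprVn mulKf // expf_neq0.
rewrite e [(-16) ^+ k.+1]exprS.
by move: (k.+1%:R^-1) ((2 * k).+1%:R) ((-16) ^+ k) => n m c; field.
Qed.

Let hdiff_pint k : (k <= h)%N -> pint p (hdiff k).
Proof.
move=> lekh; apply: pint_sum => i _; have := ltn_ord i => ltik.
by apply: pintB; apply: pintV_small; lia.
Qed.

(** For i < p - 1 an odd denominator 2i + 1 is divisible by p only if it equals p, and 2i + 2 never
    is; one factor p therefore clears the sum. *)
Let Phdiff_pint k : (k < p)%N -> pint p (P * hdiff k).
Proof.
move=> ltkp; rewrite mulr_sumr; apply: pint_sum => i _; have ltik := ltn_ord i.
rewrite mulrBr; apply: pintB.
  have [e|ne] := eqVneq p (2 * i).+1.
    by rewrite -e divff ?P_neq0 //; apply: pint1.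
  apply: pintM; first exact: pint_n.
  apply: pintV => //; rewrite prime_coprime //; apply/negP => /dvdnP[[|[|d]]]; lia.
apply: pintM; first exact: pint_n.
have -> : (2 * i).+2%:R = 2 * i.+1%:R :> rat by rewrite -natrM; congr (_%:R); lia.
by rewrite invfM; apply: pintM => //; apply: pintV_small; lia.
Qed.

Let U_large k : (h < k)%N -> U k = 0.
Proof. by move=> lt; rewrite /bterm bin_small. Qed.

Let binsq_pint k : pint p (binsq k).
Proof. exact: pint_n. Qed.

(** Past h, [binsq k] is divisible by p^2, which absorbs the possible 1/p in [hdiff k]. *)
Lemma hypG_pint : pints p p hypG.
Proof.
move=> k kp; rewrite fcoef_hypG; case: (leqP k h) => lek.
  by apply: pintM; [apply: pintM => //; exact: pint_n | apply: hdiff_pint].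
have /(pcongP pp)[t pt] := binsq_pcong kp; rewrite U_large // mulr0 add0r => ->.
have -> : 4 * (P ^+ 2 * t) * hdiff k = 4 * P * t * (P * hdiff k) by ring.
apply: pintM; last exact: Phdiff_pint.
by apply: pintM => //; apply: pintM; exact: pint_n.
Qed.

Let e16 : rat := (-16) ^+ h.

(** U h is C(2h,h) and [binsq h] is its square, so [binsq_pcong] at h gives the claim after
    cancelling C(2h,h), a divisor of (2h)! and hence prime to p. *)
Let U_h : pcong p (U h) e16.
Proof.
have hp : (h < p)%N by lia.
have cop : coprime p 'C(2 * h, h).
  have c1 := coprime_fact pp (_ : (2 * h < p)%N).
  have lh : (h <= 2 * h)%N by lia.
  have := c1 ltac:(lia); rewrite -(bin_fact lh) coprimeMr => /andP[]//.
have := binsq_pcong hp; rewrite /bterm binn mul1n addnn -mul2n -/e16 => hc.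
have -> : ('C(2 * h, h)%:R : rat) = binsq h * 'C(2 * h, h)%:R^-1.
  rewrite /binsq natrX expr2 mulfK // pnatr_eq0.
  by apply/eqP => c0; move: cop (prime_gt1 pp); rewrite c0 /coprime gcdn0 => /eqP ->.
have -> : e16 = e16 * 'C(2 * h, h)%:R * 'C(2 * h, h)%:R^-1.
  rewrite mulfK // pnatr_eq0.
  by apply/eqP => c0; move: cop (prime_gt1 pp); rewrite c0 /coprime gcdn0 => /eqP ->.
apply: pcongM => //; [|exact: pintV|exact: pcong_refl].
by apply: pintM; [apply: pintX; apply: pintN|]; exact: pint_n.
Qed.

(* Reflecting [k] to [h - k] turns the symmetry of the coefficients modulo [p]
   into a first-order correction by harmonic numbers modulo [p ^ 2]. *)
Lemma bterm_reflect k : (k <= h)%N ->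
  pcong p (U (h - k)) (e16 * U k * (1 - 2 * P * hdiff k)).
Proof.
elim: k => [|k IHk] lekh.
  rewrite subn0 /hdiff big_ord0 mulr0 subr0 mulr1 {2}/bterm !bin0 mulr1.
  exact: U_h.
have /(pcongP pp)[r pr e] := IHk (ltnW lekh).
have [n nE] : exists n : rat, n = k.+1%:R by eexists.
have [m mE'] : exists m : rat, m = (2 * k).+1%:R by eexists.
have [w wE'] : exists w : rat, w = (p - k.+1)%:R by eexists.
have wE : w = P - n by rewrite wE' nE natrB //; lia.
have mE : m = 2 * n - 1 by rewrite mE' nE natr_odd.
have n0 : n != 0 by rewrite nE pnatr_eq0.
have m0 : m != 0 by rewrite mE' pnatr_eq0.
have w0 : w != 0 by rewrite wE' pnatr_eq0; lia.
have pn : pint p n^-1 by rewrite nE; apply: pintV_small => //; lia.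
have pm : pint p m^-1 by rewrite mE'; apply: pintV_small => //; lia.
have pw : pint p w^-1 by rewrite wE'; apply: pintV_small => //; lia.
(* This is [bterm_rec] at h - k - 1, solved for the smaller index; its factor 2h - k is w = p - (k +
   1). *)
have e1 : U (h - k.+1) = U (h - k) * ((P - m) / 2) ^+ 2 / (n * w).
  have := bterm_rec h (h - k.+1).
  have -> : (h - k.+1).+1 = (h - k)%N by lia.
  have -> : (h - (h - k.+1) = k.+1)%N by lia.
  have -> : ((h + (h - k.+1)).+1 = p - k.+1)%N by lia.
  move/(congr1 (fun i : nat => i%:R : rat)); rewrite [((h - k) ^ 2 * _)%:R]natrM natrX.
  rewrite [(k.+1 * _ * _)%:R]natrM [(k.+1 * _)%:R]natrM -nE -wE'.
  have -> : (h - k)%:R = (P - m) / 2.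
    rewrite natrB ?(ltnW lekh) // mE nE -natr1.
    have -> : P = 2 * h%:R + 1 by rewrite h2 subrK.
    by field.
  by move=> e1; apply: (mulfI (mulf_neq0 n0 w0)); rewrite -e1; field; rewrite n0 w0.
have e2 : U k.+1 = (P ^+ 2 - m ^+ 2) / 4 * U k / n ^+ 2.
  by rewrite mE' nE -U_recr mulrC mulKf // -nE expf_neq0.
apply/(pcongP pp).
(* The first summand carries the old error r; the second is the difference of the two main terms
   divided by p^2. *)
exists (r * ((P - m) / 2) ^+ 2 / (n * w)
  + e16 * U k * ((P - m) / 2) / n * (n^-1 / 2)
    * ((1 - n) / (n * w) + (n * m)^-1 - 2 * hdiff k * (1 - P) / w)).
  have pP := pint_n p; have := pint_n k.+1; rewrite -nE => pnn.
  have := pint_n (2 * k).+1; rewrite -mE' => pmm.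
  have pd := hdiff_pint (ltnW lekh).
  have pe : pint p e16 by apply: pintX; apply: pintN; exact: pint_n.
  have p1 := pint1 p; have p2 := pint_n 2; have pU := pint_n (bterm h k).
  rewrite !invfM.
  by repeat first [assumption | apply: pintD | apply: pintN | apply: pintM | apply: pintX].
rewrite e1 e e2 hdiffS -mE'.
have -> : (2 * k).+2%:R = 2 * n :> rat by rewrite nE -natrM; congr (_%:R); lia.
move: n0 m0 w0; rewrite wE mE => n0 m0 w0.
by field; rewrite n0 m0 w0.
Qed.

(** The coefficient is [binsq k * (1 - 2 * P * hdiff k)], and its last factor is exactly the
    correction in [bterm_reflect]. Past h, p^2 divides [binsq k]. *)
Lemma hypFG_pcong k : (k < p)%N -> pcong p ((hypF - fconst (P / 2) * hypG) k)
  (if (k <= h)%N then (-16) ^+ k * (e16^-1 * U (h - k)) else 0).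
Proof.
move=> kp; rewrite fcoefB fcoefCM fcoef_hypF fcoef_hypG.
have -> : binsq k - P / 2 * (4 * binsq k * hdiff k) = binsq k * (1 - 2 * P * hdiff k).
  by field.
have pD : pint p (1 - 2 * P * hdiff k).
  apply: pintB; first exact: pint1.
  by rewrite -mulrA; apply: pintM; [exact: pint_n | exact: Phdiff_pint].
have p16 : pint p ((-16) ^+ k) by apply: pintX; apply: pintN; exact: pint_n.
case: leqP => lek; last first.
  have /(pcongP pp)[t pt] := binsq_pcong kp; rewrite U_large // mulr0 add0r => ->.
  by apply/(pcongP pp); exists (t * (1 - 2 * P * hdiff k)); [exact: pintM | ring].
have e0 : e16 != 0 by rewrite expf_neq0.
apply: (@pcong_trans _ ((-16) ^+ k * U k * (1 - 2 * P * hdiff k))).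
  apply: pcongM => //; first by apply: pintM => //; exact: pint_n.
    exact: binsq_pcong.
  exact: pcong_refl.
have -> : (-16) ^+ k * U k * (1 - 2 * P * hdiff k)
    = (-16) ^+ k * (e16^-1 * (e16 * U k * (1 - 2 * P * hdiff k))) by field.
apply: pcong_sym; apply: pcongM; [by [] | | exact: pcong_refl |].
  by apply: pintM; [rewrite /e16 -exprVn; apply: pintX | exact: pint_n].
apply: pcongM; [by rewrite /e16 -exprVn; apply: pintX | exact: pint_n | exact: pcong_refl |].
exact: bterm_reflect.
Qed.

(** * Assembling the sum over k1 + k2 = k3 + k4 *)

Definition fscale (c : rat) (a : fps rat) : fps rat := Fps (fun n => c ^+ n * a n).

Lemma fcoef_scale c a n : fscale c a n = c ^+ n * a n. Proof. by []. Qed.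
Lemma fscaleM c a b : fscale c (a * b) = fscale c a * fscale c b.
Proof.
apply: fpsP => n; rewrite fcoef_scale !fcoefM mulr_sumr; apply: eq_bigr => i _.
have lein : (i <= n)%N by rewrite -ltnS.
by rewrite !fcoef_scale mulrACA -exprD subnKC.
Qed.

Let A : fps rat := \sum_(k < h.+1) fconst (U k) * q ^+ k.
Let A' : fps rat := \sum_(k < h.+1) fconst (U k) * q ^+ (h - k).

Let fcoef_A k : A k = U k.
Proof.
rewrite fcoef_sum; under eq_bigr => i _ do rewrite fcoefCM fcoefXn mulr_natr.
case: (leqP k h) => [lek|ltk]; last first.
  rewrite U_large // big1 // => i _; case: eqP => // e; have := ltn_ord i; lia.
rewrite (bigD1 (Ordinal (lek : k < h.+1)%N)) //= eqxx big1 ?addr0 // => i ni.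
by case: eqP => // e; case/eqP: ni; apply: val_inj.
Qed.

Let fcoef_A' k : A' k = if (k <= h)%N then U (h - k) else 0.
Proof.
rewrite fcoef_sum; under eq_bigr => i _ do rewrite fcoefCM fcoefXn mulr_natr.
case: (leqP k h) => [lek|ltk]; last first.
  by rewrite big1 // => i _; case: eqP => // e; have := ltn_ord i; lia.
have ltk : (h - k < h.+1)%N by lia.
rewrite (bigD1 (Ordinal ltk)) //= subKn // eqxx big1 ?addr0 // => i ni.
case: eqP => // e; case/eqP: ni; apply: val_inj => /=; have := ltn_ord i; lia.
Qed.

(** A' is A read backwards, so index 2h selects k1 + k2 + (h - k3) + (h - k4) = 2h. *)
Lemma apery_sumE : (apery_sum p)%:~R = (A * A * (A' * A')) (2 * h)%N.
Proof.
have -> : A * A * (A' * A') = \sum_(k1 < h.+1) \sum_(k2 < h.+1) \sum_(k3 < h.+1)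
    \sum_(k4 < h.+1) fconst (U k1 * U k2 * U k3 * U k4)
      * q ^+ (k1 + k2 + ((h - k3) + (h - k4))).
  rewrite -mulrA {1}/A mulr_suml; apply: eq_bigr => k1 _.
  rewrite {1}/A mulr_suml mulr_sumr; apply: eq_bigr => k2 _.
  rewrite {1}/A' mulr_suml !mulr_sumr; apply: eq_bigr => k3 _.
  rewrite /A' !mulr_sumr; apply: eq_bigr => k4 _.
  by rewrite !rmorphM !exprD; ring.
rewrite /apery_sum -/h rmorph_sum fcoef_sum; apply: eq_bigr => k1 _.
rewrite rmorph_sum fcoef_sum; apply: eq_bigr => k2 _.
rewrite rmorph_sum fcoef_sum; apply: eq_bigr => k3 _.
rewrite rmorph_sum fcoef_sum; apply: eq_bigr => k4 _.
rewrite fcoefCM fcoefXn; have l3 := ltn_ord k3; have l4 := ltn_ord k4.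
have -> : (2 * h == k1 + k2 + (h - k3 + (h - k4)))%N = (k1 + k2 == k3 + k4)%N by lia.
case: ifP => _; last by rewrite mulr0.
rewrite mulr1 -[LHS]/((binom_term h k1 * binom_term h k2 * binom_term h k3
  * binom_term h k4)%:~R).
by rewrite !intrM -!pmulrn.
Qed.

(** F^2 (F - p G/2)^2 differs from F^4 - p F^3 G by p^2 F^2 G^2/4. Its factors are then replaced by
    A and A' with X scaled by -16; at index 2h the scaling (-16)^(2h) cancels the two factors
    [e16^-1]. *)
Lemma hyp_apery :
  pcong p ((hypF ^+ 4 - p%:R * hypF ^+ 3 * hypG) p.-1) (apery_sum p)%:~R.
Proof.
have e0 : e16 != 0 by rewrite expf_neq0.
have ltp : (p.-1 < p)%N by rewrite prednK ?prime_gt0.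
pose F' := hypF - fconst (P / 2) * hypG.
have pF : pints p p hypF by move=> n _; exact: binsq_pint.
have pF' : pints p p F'.
  apply: pintsB => //; apply: pintsM; last exact: hypG_pint.
  case=> [|n] _; last exact: pint0.
  by apply: pintM => //; exact: pint_n.
apply: (@pcong_trans _ ((hypF * hypF * (F' * F')) p.-1)).
  apply: pcong_sym; apply/(pcongP pp).
  exists ((fconst (2^-1 ^+ 2) * (hypF ^+ 2 * hypG ^+ 2)) p.-1).
    rewrite fcoefCM; apply: pintM; first exact: pintX.
    have hp : pints p p (hypF ^+ 2 * hypG ^+ 2).
      by apply: pintsM; apply: pintsX => //; exact: hypG_pint.
    exact: hp.
  rewrite -natrX -fcoef_natM -fcoefD; congr (fcoef _ _).
  rewrite /F' rmorphM rmorphXn !(rmorph_nat _ p) natrX /=.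
  have e2 : fconst 2^-1 * 2 = 1 :> fps rat.
    by rewrite -(rmorph_nat (@fconst rat) 2) -rmorphM mulVf ?rmorph1.
  move: (fconst 2^-1) e2 => c e2.
  transitivity (hypF ^+ 4 - (c * 2) * p%:R * hypF ^+ 3 * hypG
    + p%:R ^+ 2 * (c ^+ 2 * (hypF ^+ 2 * hypG ^+ 2))); first by ring.
  by rewrite e2 mul1r.
pose B := fscale (-16) A; pose B' := fconst e16^-1 * fscale (-16) A'.
have cF : pcongs p p hypF B.
  by move=> k kp; rewrite fcoef_scale fcoef_A; apply: binsq_pcong.
have cF' : pcongs p p F' B'.
  move=> k kp; have := hypFG_pcong kp; rewrite fcoefCM fcoef_scale fcoef_A' -/F'.
  by case: ifP => _; rewrite ?mulr0 // mulrCA.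
have pB : pints p p B.
  by move=> k kp; apply: pcong_pint (pF k kp) => //; apply: pcong_sym; apply: cF.
have pB' : pints p p B'.
  by move=> k kp; apply: pcong_pint (pF' k kp) => //; apply: pcong_sym; apply: cF'.
have -> : (apery_sum p)%:~R = (B * B * (B' * B')) p.-1.
  have -> : B * B * (B' * B') = fconst (e16^-1 ^+ 2) * fscale (-16) (A * A * (A' * A')).
    by rewrite !fscaleM rmorphXn /B /B'; ring.
  have -> : p.-1 = (2 * h)%N by lia.
  have s16 : (-16) ^+ (2 * h) = e16 ^+ 2 :> rat by rewrite mulnC exprM.
  rewrite fcoefCM fcoef_scale s16 exprVn mulKf ?expf_neq0 //.
  exact: apery_sumE.
have : pcongs p p (hypF * hypF * (F' * F')) (B * B * (B' * B')).
  apply: pcongsM; [exact: pintsM | exact: pintsM | exact: pcongsM | exact: pcongsM].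
exact.
Qed.

End Apery.

Theorem theorem5p1 (p : nat) :
  prime p -> odd p ->
  (gamma p = apery_sum p %[mod (p ^ 2)%:Z])%Z.
Proof.
move=> pp odd_p; apply: pcong_int => //.
exact: pcong_trans (gamma_pcong pp) (hyp_apery pp odd_p).
Qed.
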